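(* Let $\mu$ be an $(\alpha_1,\alpha_2)$-weakly dependent spin system on $\mathcal Y=\mathcal X^{\mathcal I}$ ($\mathcal X,\mathcal I$ finite, $\alpha_1,\alpha_2>0$). (1) For any function $f:\mathcal Y\to[0,\infty)$ vanishing outside of $\operatorname{supp}\mu$ we have $$\mathrm{Ent}_\mu(f)\le\frac1{\alpha_1\alpha_2^2}\sum_{i\in\mathcal I}\int\mathrm{Ent}_{\mu(\cdot\mid\overline x_i)}(f(\overline x_i,\cdot))\,d\mu(x).$$ (2) $\mu$ (i.e. its Glauber dynamics) satisfies $\mathrm{mLSI}(\rho_0)$ for $\rho_0=2|\mathcal I|\alpha_1^{-1}\alpha_2^{-2}$. (3) $\mu$ satisfies a $\mathfrak d\text{-}\mathrm{LSI}(\sigma^2)$ for $\sigma^2=\log(\alpha_1^{-1})\,(\log(2)\,\alpha_1\alpha_2^2)^{-1}$.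
   Context: A (finite) spin system is a probability measure $\mu$ on $\mathcal Y=\mathcal X^{\mathcal I}$ with $\mathcal X,\mathcal I$ finite; $\operatorname{supp}\mu=\{y:\mu(y)>0\}$. For $x\in\mathcal Y$, $\overline{x}_i=(x_j)_{j\ne i}$, and $\mu(\cdot\mid\overline x_i)$ denotes the conditional probability of the $i$-th coordinate given the others, interpreted as a measure on $\mathcal X$. Interdependence matrix: any matrix $J=(J_{ij})_{i,j\in\mathcal I}$ with $J_{ii}=0$ and such that for any $x,y\in\mathcal Y$ with $\overline x_j=\overline y_j$ we have $d_{\mathrm{TV}}(\mu(\cdot\mid\overline x_i),\mu(\cdot\mid\overline y_i))\le J_{ij}$, where $d_{\mathrm{TV}}(\mu_1,\mu_2)=\frac12\sum_x|\mu_1(x)-\mu_2(x)|$. $\|J\|_{2\to2}$ is the operator norm with respect to the Euclidean norm. For $S\subsetneq\mathcal I$ and $i\notin S$ let $$\tilde\beta_{i,S}(\mu)=\inf_{x_S\in\mathcal X^S:\ \mu_S(x_S)>0}\ \inf_{y_{S^c}\in\mathcal X^{S^c}:\ \mu(y_{S^c},x_S)>0}\mu((y_{S^c})_i\mid x_S),$$ where $\mu_S$ is the marginal of $\mu$ on $\mathcal X^S$ and $\mu((y_{S^c})_i\mid x_S)$ is the conditional probability that the $i$-th coordinate equals $(y_{S^c})_i$ given that the coordinates in $S$ equal $x_S$ (for $S=\emptyset$: the marginal probability). Set $\tilde\beta(\mu)=\inf_{S\subsetneq\mathcal I}\inf_{i\notin S}\tilde\beta_{i,S}(\mu)$. $\mu$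 is $(\alpha_1,\alpha_2)$-weakly dependent if, for some interdependence matrix $J$, $\tilde\beta(\mu)\ge\alpha_1$ and $\|J\|_{2\to2}\le1-\alpha_2$. $\mathrm{Ent}_\nu(g)=\mathbb E_\nu g\log g-\mathbb E_\nu g\log\mathbb E_\nu g$ for $g\ge0$. Glauber dynamics: the Markov chain on $\operatorname{supp}\mu$ with transition matrix $P(x,y)=|\mathcal I|^{-1}\sum_{i\in\mathcal I}\mu(y_i\mid\overline x_i)\prod_{j\ne i}\mathbf 1_{x_j=y_j}$; $L=P-I$, $\mathcal E(f,g)=\mathbb E_\mu f(-Lg)$. $\mathrm{mLSI}(\rho_0)$ means $\mathrm{Ent}_\mu(f)\le\frac{\rho_0}2\mathcal E(f,\log f)$ for all $f:\operatorname{supp}\mu\to(0,\infty)$. $\mathfrak d_if(x)^2=\frac12\iint(f(\overline x_i,y)-f(\overline x_i,y'))^2\,d\mu(y\mid\overline x_i)\,d\mu(y'\mid\overline x_i)$ if $\overline x_i$ has positive marginal probability, and $0$ otherwise; $|\mathfrak df|=(\sum_i(\mathfrak d_if)^2)^{1/2}$. $\mathfrak d\text{-}\mathrm{LSI}(\sigma^2)$ means $\mathrm{Ent}_\mu(f^2)\le2\sigma^2\int|\mathfrak df|^2d\mu$ for all $f:\mathcal Y\to\mathbb R$.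
   Formalization: In the definition of an interdependence matrix, conditional laws given outside configurations of zero probability, which are undefined, are taken from some choice of probability kernel depending only on those coordinates, and the bound is required for all x, y for that choice. *)

(* Defs.v *)
From mathcomp Require Import all_boot all_order all_algebra.
From mathcomp Require Import classical_sets reals constructive_ereal ereal exp.

Set Implicit Arguments.
Unset Strict Implicit.
Unset Printing Implicit Defensive.

Import Order.TTheory GRing.Theory Num.Theory.
Local Open Scope ring_scope.

Section FiniteMeasures.
Context {R : realType} {T : finType}.
Implicit Types nu : T -> R.

(* Measures on a finite type are given by their mass functions. *)
Definition is_prob nu := (forall x, 0 <= nu x) /\ \sum_x nu x = 1.

Definition supp nu := [pred x | 0 < nu x].

Definition expect nu (g : T -> R) : R := \sum_x nu x * g x.

(* [ln 0 = 0], so that [0 * ln 0 = 0] as usual. *)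
Definition Ent nu (g : T -> R) : R :=
  expect nu (fun x => g x * ln (g x)) - expect nu g * ln (expect nu g).

Definition dTV nu1 nu2 : R := 2^-1 * \sum_x `|nu1 x - nu2 x|.

End FiniteMeasures.

Section OperatorNorm.
Context {R : realType} {I : finType}.

Definition norm2 (v : I -> R) : R := Num.sqrt (\sum_i v i ^+ 2).

Definition apply_mx (J : I -> I -> R) (v : I -> R) : I -> R :=
  fun i => \sum_j J i j * v j.

Definition opnorm2 (J : I -> I -> R) : R :=
  sup [set norm2 (apply_mx J v) | v in [set v | norm2 v <= 1]]%classic.

End OperatorNorm.

Section SpinSystems.
Context {R : realType} {X I : finType}.
Notation Y := {ffun I -> X}.
Implicit Types (mu : Y -> R) (S : {set I}) (i j : I) (x y z : Y) (a b : X).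

(* A partial configuration [x_S] is represented by any [x : Y] extending it:
   the definitions below that take [S] and [x] depend on [x] only through its
   coordinates in [S].  The configuration [x] without its [i]-th coordinate is
   the case [S = ~: [set i]]. *)
Definition agree S x y := [forall j in S, x j == y j].

(* the configuration (y_{S^c}, x_S) *)
Definition glue S x y : Y := [ffun j => if j \in S then x j else y j].

(* the configuration equal to [x] off [i] and to [a] at [i] *)
Definition upd x i a : Y := [ffun j => if j == i then a else x j].

(* mu_S(x_S) *)
Definition marg mu S x : R := \sum_(z | agree S x z) mu z.

(* Conditional probability that the [i]-th coordinate is [a] given [x_S];
   meaningful only if [0 < marg mu S x]. *)
Definition cond mu S x i a : R :=
  (\sum_(z | agree S x z && (z i == a)) mu z) / marg mu S x.

(* conditional law of the [i]-th coordinate given all the others *)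
Definition condi mu x i : X -> R := cond mu (~: [set i]) x i.

(* A version of the conditional laws given all other coordinates: a probability
   kernel, arbitrary at conditions of zero marginal probability. *)
Definition is_version mu (K : Y -> I -> X -> R) :=
  [/\ forall x i, is_prob (K x i),
      forall x y i, agree (~: [set i]) x y -> K x i =1 K y i
    & forall x i, 0 < marg mu (~: [set i]) x -> K x i =1 condi mu x i].

(* The bound is required for all configurations, for some version of the
   conditional laws.  Requiring it only where both conditionals are determined
   by [mu] would be too weak: [J = 0] would then qualify for the uniform measure
   on the two constant configurations of {0,1}^3. *)
Definition interdependence mu (J : I -> I -> R) :=
  (forall i, J i i = 0) /\
  exists2 K, is_version mu K &
    forall i j x y, agree (~: [set j]) x y -> dTV (K x i) (K y i) <= J i j.

(* Extended real infima, so that the infimum over the empty set is [+oo]. *)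
Definition beta_tilde_at mu i S : \bar R :=
  ereal_inf [set ereal_inf [set (cond mu S x i (y i))%:E
                           | y in [set y | 0 < mu (glue S x y)]]
            | x in [set x | 0 < marg mu S x]]%classic.

Definition beta_tilde mu : \bar R :=
  ereal_inf [set ereal_inf [set beta_tilde_at mu i S | i in [set i | i \notin S]]
            | S in [set S : {set I} | S \proper finset.setT]]%classic.

Definition weakly_dependent mu (alpha1 alpha2 : R) :=
  exists2 J, interdependence mu J &
    (alpha1%:E <= beta_tilde mu)%E /\ opnorm2 J <= 1 - alpha2.

Notation suppT mu := {x : Y | x \in supp mu}.

Definition glauber mu (u v : suppT mu) : R :=
  #|I|%:R^-1 *
  \sum_i condi mu (val u) i (val v i) *
         \prod_(j | j != i) (val u j == val v j)%:R.

Definition generator mu (g : suppT mu -> R) : suppT mu -> R :=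
  fun u => \sum_v glauber u v * g v - g u.

Definition dirichlet mu (f g : suppT mu -> R) : R :=
  expect (mu \o val) (fun u => f u * - generator g u).

Definition mLSI mu (rho0 : R) :=
  forall f : suppT mu -> R, (forall u, 0 < f u) ->
    Ent (mu \o val) f <= rho0 / 2 * dirichlet f (fun u => ln (f u)).

Definition diff_i mu (f : Y -> R) i x : R :=
  if 0 < marg mu (~: [set i]) x then
    Num.sqrt (2^-1 * \sum_a \sum_b
      (f (upd x i a) - f (upd x i b)) ^+ 2 * condi mu x i a * condi mu x i b)
  else 0.

Definition diff_norm mu (f : Y -> R) x : R :=
  Num.sqrt (\sum_i diff_i mu f i x ^+ 2).

Definition dLSI mu (sigma2 : R) :=
  forall f : Y -> R,
    Ent mu (fun x => f x ^+ 2) <=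
      2 * sigma2 * expect mu (fun x => diff_norm mu f x ^+ 2).

End SpinSystems.

(* Main.v *)
Require Import Defs.
From mathcomp Require Import all_boot all_order all_algebra.
From mathcomp Require Import classical_sets reals constructive_ereal ereal exp.
From mathcomp Require Import functions unstable filter topology normedtype.
From mathcomp Require Import derive realfun convex.
From mathcomp Require Import ring lra.
Import Order.TTheory GRing.Theory Num.Theory.
Import numFieldNormedType.Exports.
Local Open Scope ring_scope.

Set Implicit Arguments.
Unset Strict Implicit.
Unset Printing Implicit Defensive.

(** Marton's induction.  Write [E_S] and [Ent_S] for conditional expectation and
    entropy given the coordinates in [S].  Averaging the chain rule
      [Ent_S f = E_S (Ent_(S+i) f) + Ent_S (E_(S+i) f)]
    over [i] outside [S], the first terms are handled by induction on the number
    of free coordinates.  In the second terms, [E_(S+i) f] depends on the single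
    coordinate [i], whose conditional law has atoms at least [alpha1]; comparing
    with the chi-square divergence,
      [Ent_S (E_(S+i) f) <= 2 / (F alpha1) * h_i^2]
    with [F = E_S f] and [h_i = E_S |E_(S+i) f - F| / 2].  Dobrushin's comparison
    theorem bounds [sum_i h_i^2] by [alpha2^-2 sum_i e_i^2], where [e_i] is the
    mean total variation error [E_S |f - E_(~i) f| / 2] at site [i], and Pinsker's
    inequality with Cauchy-Schwarz gives [e_i^2 <= F / 2 * E_S (Ent_(~i) f)].

    The modified log-Sobolev inequality follows since [Ent f <= Cov (f, ln f)] at
    each site, and the [d]-LSI from the one-site inequality
    [Ent (g^2) <= 2 log2 (1 / alpha) Var g] for measures with atoms at least
    [alpha]. *)

(** * Two rational bounds for the logarithm *)

(** By the mean value theorem on either side of [1]: a derivative with the sign of [t - 1] makes [1]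
    a global minimum. *)
Lemma ge0_of_sign_deriv (R : realType) (f df : R -> R) :
  (forall t : R, 0 < t -> is_derive t 1 f (df t)) -> f 1 = 0 ->
  (forall t, 0 < t -> 0 <= df t * (t - 1)) ->
  forall t, 0 < t -> 0 <= f t.
Proof.
move=> dfP f1 sgn t t0.
have cont (a b : R) : 0 < a -> {within `[a, b], continuous f}%classic.
  move=> a0; apply: derivable_within_continuous => s.
  rewrite in_itv /= => /andP[as_ _].
  by have [] := dfP s (lt_le_trans a0 as_).
have ftc (a b : R) : 0 < a -> a < b ->
    exists2 c, a < c < b & f b - f a = df c * (b - a).
  move=> a0 ab.
  have [|c + ->] := @MVT R f df a b ab _ (cont a b a0); last by rewrite in_itv => ?; exists c.
  by move=> s; rewrite in_itv /= => /andP[/(lt_trans a0) s0 _]; exact: dfP.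
have [t1|t1|->] := ltgtP t 1; last by rewrite f1.
- have [s /andP[ts s1] H] := ftc t 1 t0 t1.
  have := sgn s (lt_trans t0 ts); nra.
- have [s /andP[s1 st] H] := ftc 1 t ltr01 t1.
  have := sgn s (lt_trans ltr01 s1); nra.
Qed.

(** The difference of the two sides has derivative [(t - 1)^3 / (3 t^3)]. Multiplied by [2 t^2],
    this is the bound of [sqr_ln_le_cubic]. *)
Lemma ln_le_rational (R : realType) (t : R) : 0 < t ->
  ln t <= 3^-1 * t + 2^-1 - t^-1 + 6^-1 * t^-1 ^+ 2.
Proof.
move=> t0; rewrite -subr_ge0.
move: t t0; apply: (@ge0_of_sign_deriv _ _
  (fun t => (t - 1) ^+ 3 / (3 * t ^+ 3))).
- move=> t t0.
  have tn0 : t != 0 by rewrite gt_eqF.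
  have dV := is_deriveV tn0 (is_derive_id t 1).
  have := is_deriveB (is_deriveD (is_deriveB (is_deriveD
    (is_deriveZ 3^-1 (is_derive_id t (1:R))) (is_derive_cst (2^-1:R) t 1)) dV)
    (is_deriveZ 6^-1 (is_deriveX 2 dV))) (is_derive1_ln t0).
  move=> /is_derive_eq; apply.
  by rewrite /GRing.scale /=; field.
- by rewrite ln1; field.
- move=> t t0.
  have -> : (t - 1) ^+ 3 / (3 * t ^+ 3) * (t - 1) = (t - 1) ^+ 4 / (3 * t ^+ 3).
    by field; rewrite gt_eqF.
  by rewrite divr_ge0 ?exprn_even_ge0// mulr_ge0// exprn_ge0// ltW.
Qed.

(** The left side is [(t - 1) (5 t + 1) / (t (2 t + 4))] in partial fractions, which is what
    [sqr_sub1_le_entropy] asks for when solved for [ln t]. *)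
Lemma ln_ge_rational (R : realType) (t : R) : 0 < t ->
  5 / 2 - 4^-1 * t^-1 - 27 / 4 * (t + 2)^-1 <= ln t.
Proof.
move=> t0; rewrite -subr_ge0.
move: t t0; apply: (@ge0_of_sign_deriv _ _
  (fun t => (t - 1) ^+ 3 / (t ^+ 2 * (t + 2) ^+ 2))).
- move=> t t0.
  have tn0 : t != 0 by rewrite gt_eqF.
  have t2n0 : t + 2 != 0 by rewrite gt_eqF// addr_gt0.
  have dV := is_deriveV tn0 (is_derive_id t 1).
  have dV2 := @is_deriveV R (id + cst (2 : R)) t _ 1 t2n0
    (is_deriveD (is_derive_id t 1) (is_derive_cst (2 : R) t 1)).
  have := is_deriveB (is_derive1_ln t0) (is_deriveB (is_deriveB
    (is_derive_cst (5 / 2 : R) t 1) (is_deriveZ 4^-1 dV)) (is_deriveZ (27 / 4) dV2)).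
  move=> /is_derive_eq; apply.
  rewrite -[LHS]/(t^-1 - (0 - 4^-1 * (- t ^- 2 * 1)
    - 27 / 4 * (- (t + 2) ^- 2 * (1 + 0)))).
  by field; rewrite tn0 t2n0.
- by rewrite ln1; field.
- move=> t t0.
  have -> : (t - 1) ^+ 3 / (t ^+ 2 * (t + 2) ^+ 2) * (t - 1)
     = (t - 1) ^+ 4 / (t ^+ 2 * (t + 2) ^+ 2).
    by field; rewrite !gt_eqF// addr_gt0.
  by rewrite divr_ge0 ?exprn_even_ge0// mulr_ge0 ?exprn_even_ge0.
Qed.

Lemma sqr_sub1_le_entropy (R : realType) (t : R) : 0 <= t ->
  3 * (t - 1) ^+ 2 <= (2 * t + 4) * (t * ln t - t + 1).
Proof.
(* At [t = 0] the convention for [ln 0] leaves [3 <= 4]. *)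
rewrite le_eqVlt => /predU1P[<-|t0]; first by rewrite ln0//; lra.
have := ln_ge_rational t0.
have -> : 5 / 2 - 4^-1 * t^-1 - 27 / 4 * (t + 2)^-1 =
    ((t - 1) * (5 * t + 1)) / (t * (2 * t + 4)).
  by field; rewrite !gt_eqF// ?addr_gt0// ?mulr_gt0// addr_gt0.
rewrite ler_pdivrMr; last by rewrite mulr_gt0// addr_gt0// mulr_gt0.
nra.
Qed.

(** The right side is the Taylor polynomial of degree three of the left side at [1]. *)
Lemma sqr_ln_le_cubic (R : realType) (t : R) : 0 <= t ->
  2 * t ^+ 2 * ln t - t ^+ 2 + 1 <= 2 * (t - 1) ^+ 2 + 2 / 3 * (t - 1) ^+ 3.
Proof.
rewrite le_eqVlt => /predU1P[<-|t0]; first by rewrite ln0//; lra.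
have H : 2 * t ^+ 2 * ln t <=
    2 * t ^+ 2 * (3^-1 * t + 2^-1 - t^-1 + 6^-1 * t^-1 ^+ 2).
  by rewrite ler_pM2l ?ln_le_rational// mulr_gt0// exprn_gt0.
rewrite -lerBrDr lerBlDr (le_trans H)// le_eqVlt.
by apply/predU1P; left; field; rewrite gt_eqF.
Qed.

(** The constant is [(6 / 7)^2], to match [t / (t - 1) <= 7 / 6] for [t >= 7] in [expect_sqr_ln_le];
    the cubic bound at [2] even gives [17 / 24]. *)
Lemma ln2_le (R : realType) : ln 2 <= 36 / 49 :> R.
Proof. by have := @sqr_ln_le_cubic R 2 (ler0n _ _); lra. Qed.

(** By concavity [ln] lies above its chord from [2] to [8], and [ln 8 = 3 ln 2]. *)
Lemma ln_chord (R : realType) (t : R) : 2 <= t <= 8 ->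
  (t + 1) / 3 * ln 2 <= ln t.
Proof.
move=> /andP[t2 t8].
have s01 : 0 <= (8 - t) / 6 <= 1 by lra.
have := concave_ln (Itv01 (andP s01).1 (andP s01).2) (@ltr0n R 2) (@ltr0n R 8).
have -> : ln 8 = 3 * ln 2 :> R.
  by rewrite (_ : 8 = 2 ^+ 3) ?lnXn ?mulr_natl// -natrX.
rewrite !convRE /= [X in _ <= ln X -> _](_ : _ = t); last by rewrite /onem; lra.
by rewrite /onem; lra.
Qed.

(** * Log-Sobolev inequality for a measure with bounded-below atoms *)

Section Expectation.
Context {R : realType} {T : finType} (nu : T -> R).
Hypothesis nu_ge0 : forall x, 0 <= nu x.
Implicit Types (f g : T -> R) (c : R).

Lemma ler_expect f g :
  (forall x, 0 < nu x -> f x <= g x) -> expect nu f <= expect nu g.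
Proof.
move=> fg; apply: ler_sum => x _.
have := nu_ge0 x; rewrite le_eqVlt => /predU1P[<-|nux]; first by rewrite !mul0r.
by rewrite ler_pM2l ?fg.
Qed.

Lemma eq_expect f g :
  (forall x, 0 < nu x -> f x = g x) -> expect nu f = expect nu g.
Proof.
by move=> fg; apply: le_anti; rewrite !ler_expect// => x /fg ->.
Qed.

Lemma expect_ge0 g : (forall x, 0 < nu x -> 0 <= g x) -> 0 <= expect nu g.
Proof.
move=> g0; rewrite (le_trans _ (ler_expect g0))// /expect.
by rewrite big1// => x _; rewrite mulr0.
Qed.

Lemma eq_Ent f g : (forall x, 0 < nu x -> f x = g x) -> Ent nu f = Ent nu g.
Proof.
move=> fg; rewrite /Ent (eq_expect fg); congr (_ - _).
by apply: eq_expect => x /fg ->.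
Qed.

Lemma expectD f g : expect nu (fun x => f x + g x) = expect nu f + expect nu g.
Proof. by rewrite -big_split; apply: eq_bigr => x _; rewrite mulrDr. Qed.

Lemma expectB f g : expect nu (fun x => f x - g x) = expect nu f - expect nu g.
Proof. by rewrite -sumrB; apply: eq_bigr => x _; rewrite mulrBr. Qed.

Lemma expectZ c g : expect nu (fun x => c * g x) = c * expect nu g.
Proof. by rewrite mulr_sumr; apply: eq_bigr => x _; rewrite mulrCA. Qed.

Lemma expect_sum (J : finType) (P : pred J) (F : J -> T -> R) :
  expect nu (fun x => \sum_(j | P j) F j x) = \sum_(j | P j) expect nu (F j).
Proof.
by rewrite exchange_big; apply: eq_bigr => x _; rewrite mulr_sumr.
Qed.

Lemma ler_norm_expect g : `|expect nu g| <= expect nu (fun x => `|g x|).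
Proof.
rewrite (le_trans (ler_norm_sum _ _ _))// ler_sum// => x _.
by rewrite normrM ger0_norm.
Qed.

Lemma expect_eq0 g : (forall x, 0 < nu x -> 0 <= g x) -> expect nu g = 0 ->
  forall x, 0 < nu x -> g x = 0.
Proof.
move=> g0 Eg x nux; have /psumr_eq0P/(_ Eg)/(_ x isT) : forall y, predT y -> 0 <= nu y * g y.
  move=> y _; have := nu_ge0 y; rewrite le_eqVlt => /predU1P[<-|nuy]; first by rewrite mul0r.
  by rewrite mulr_ge0// g0.
by move=> /eqP; rewrite mulf_eq0 gt_eqF//= => /eqP.
Qed.

Hypothesis nu1 : \sum_x nu x = 1.

Lemma expect_cst c : expect nu (fun=> c) = c.
Proof. by rewrite /expect -mulr_suml nu1 mul1r. Qed.

(** The variance as half the mean squared difference of two independent copies; after centering at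
    the mean, the cross term vanishes. *)
Lemma half_sum_sqr_sub g :
  2^-1 * (\sum_a \sum_b (g a - g b) ^+ 2 * nu a * nu b) =
  expect nu (fun a => (g a - expect nu g) ^+ 2).
Proof.
set m := expect nu g; have Em : expect nu (fun x => g x - m) = 0.
  by rewrite expectB expect_cst subrr.
have E a : \sum_b (g a - g b) ^+ 2 * nu a * nu b =
    nu a * ((g a - m) ^+ 2 + expect nu (fun b => (g b - m) ^+ 2)).
  transitivity (nu a * expect nu (fun b => (g a - m) ^+ 2 -
      2 * (g a - m) * (g b - m) + (g b - m) ^+ 2)).
    by rewrite /expect mulr_sumr; apply: eq_bigr => b _; ring.
  by rewrite expectD expectB expectZ Em mulr0 subr0 expect_cst.
under eq_bigr do rewrite E.
by rewrite -/(expect _ _) expectD expect_cst; lra.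
Qed.

End Expectation.

Lemma sub1V_le_ln {R : realType} (x : R) : 0 < x -> 1 - x^-1 <= ln x.
Proof.
move=> x0; have := @le_ln1Dx R (x^-1 - 1).
rewrite addrCA subrr addr0 lnV ?posrE// => /(_ _).
by rewrite ltrBrDr addNr invr_gt0 x0 => /(_ isT); lra.
Qed.

Lemma prob_supp {R : realType} {T : finType} (nu : T -> R) :
  is_prob nu -> exists a, 0 < nu a.
Proof.
move=> [nu_ge0 nu1]; apply/existsP; apply: contraT => /existsPn H.
have := nu1; rewrite big1 => [/esym/eqP|a _]; first by rewrite oner_eq0.
by apply: le_anti; rewrite nu_ge0 leNgt H.
Qed.

(** * Measures whose atoms of positive mass are at least [1 / K] *)

Section OneSite.
Context {R : realType} {T : finType} (nu : T -> R) (K : R).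
Hypotheses (nu_prob : is_prob nu) (atomK : forall a, 0 < nu a -> 1 <= K * nu a).
Let nu_ge0 := nu_prob.1.
Let nu1 := nu_prob.2.

Lemma prob_le1 a : nu a <= 1.
Proof. by rewrite -nu1 (bigD1 a)//= lerDl sumr_ge0. Qed.

(* The only atom with [t a > K - 1] carries so much mass that all other atoms
   satisfy [t b <= K - t a]; their contribution then compensates exactly. *)
Lemma third_moment_le t : 2 <= K ->
  (forall a, 0 <= t a) -> expect nu t = 1 ->
  expect nu (fun a => (t a - 1) ^+ 3) <=
    (K - 2) * expect nu (fun a => (t a - 1) ^+ 2).
Proof.
move=> K2 t0 t1; rewrite -subr_ge0 -expectZ -expectB.
rewrite (_ : expect _ _ = expect nu (fun a => (t a - 1) ^+ 2 * (K - 1 - t a))); last first.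
  by apply: eq_bigr => a _; ring.
have [/existsP[a /andP[nua tK]]|/existsPn H] :=
  boolP [exists a, (0 < nu a) && (K - 1 < t a)]; last first.
  apply: expect_ge0 => // a nua; rewrite mulr_ge0 ?sqr_ge0//.
  by have := H a; rewrite nua -leNgt; lra.
have t_le b : b != a -> 0 < nu b -> t b <= K - t a.
  move=> ba nub.
  have : nu a * t a + nu b * t b <= 1.
    rewrite -t1 /expect (bigD1 a)//= (bigD1 b)//= addrA lerDl sumr_ge0// => c _.
    by rewrite mulr_ge0.
  have := atomK nub; have := atomK nua; have := t0 a; have := t0 b; nra.
rewrite /expect (bigD1 a)//=.
have S : \sum_(b | b != a) nu b * (1 - t b) = nu a * (t a - 1).
  have : expect nu (fun b => 1 - t b) = 0 by rewrite expectB expect_cst// t1 subrr.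
  by rewrite /expect (bigD1 a)//=; lra.
(* As [t b <= K - t a < 1], both [1 - t b >= t a + 1 - K] and [K - 1 - t b >= t a - 1]. By [S], the
   sum of these lower bounds is minus the term of [a]. *)
have : (t a - 1) * (t a + 1 - K) * \sum_(b | b != a) nu b * (1 - t b) <=
    \sum_(b | b != a) nu b * ((t b - 1) ^+ 2 * (K - 1 - t b)).
  rewrite mulr_sumr ler_sum// => b ba.
  have := nu_ge0 b; rewrite le_eqVlt => /predU1P[<-|nub]; first by rewrite !mul0r mulr0.
  rewrite mulrCA ler_pM2l//.
  have := t_le b ba nub => tb.
  have -> : (t b - 1) ^+ 2 * (K - 1 - t b) = (1 - t b) * ((1 - t b) * (K - 1 - t b)) by ring.
  rewrite mulrC ler_pM2l; last by lra.
  rewrite mulrC ler_pM//; lra.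
rewrite S; lra.
Qed.

(* Three regimes: for [K < 2] there is a single atom; for [2 <= K <= 8] the cubic
   bound and [third_moment_le] suffice, as [log2 K >= (K + 1) / 3] there; for
   [8 < K] the inequality already holds pointwise. *)
Lemma expect_sqr_ln_le t : (forall a, 0 <= t a) -> expect nu t = 1 ->
  expect nu (fun a => 2 * t a ^+ 2 * ln (t a) - t a ^+ 2 + 1) <=
    2 * (ln K / ln 2) * expect nu (fun a => (t a - 1) ^+ 2).
Proof.
move=> t0 t1.
have [a0 nua0] := prob_supp nu_prob.
have K1 : 1 <= K by have := atomK nua0; have := prob_le1 a0; nra.
have lnK0 : 0 <= ln K by apply: ln_ge0.
have l2 : 0 < ln 2 :> R by rewrite ln_gt0// ltr1n.
have tK a : 0 < nu a -> t a <= K.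
  move=> nua; have : nu a * t a <= 1.
    by rewrite -t1 /expect (bigD1 a)//= lerDl sumr_ge0// => c _; rewrite mulr_ge0.
  by have := atomK nua; have := t0 a; nra.
have [K2|K2] := ltP K 2.
  have atom b : b != a0 -> nu b = 0.
    move=> ba; apply: le_anti; rewrite nu_ge0 andbT leNgt; apply/negP => nub.
    have : nu a0 + nu b <= 1.
      by rewrite -nu1 (bigD1 a0)//= (bigD1 b)//= addrA lerDl sumr_ge0.
    by have := atomK nub; have := atomK nua0; nra.
  have E f : expect nu f = nu a0 * f a0.
    by rewrite /expect (bigD1 a0)//= big1 ?addr0// => b /atom ->; rewrite mul0r.
  have nu1a : nu a0 = 1 by have := nu1; rewrite (bigD1 a0)//= big1// addr0.
  have ta1 : t a0 = 1 by rewrite -t1 E nu1a mul1r.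
  by rewrite !E ta1 ln1; lra.
have [K8|K8] := leP K 8.
  have H := ler_expect nu_ge0 (fun a _ => sqr_ln_le_cubic (t0 a)).
  apply: (le_trans H); rewrite expectD !expectZ.
  have H3 := third_moment_le K2 t0 t1.
  have V0 : 0 <= expect nu (fun a => (t a - 1) ^+ 2).
    by apply: expect_ge0 => // a _; rewrite sqr_ge0.
  (* The cubic bound and [H3] give the factor [2 + (2 / 3) (K - 2) = 2 (K + 1) / 3] in front of the
     variance. *)
  have : (K + 1) / 3 <= ln K / ln 2 by rewrite ler_pdivlMr// ln_chord// K2 K8.
  by nra.
rewrite -expectZ; apply: ler_expect => // a nua.
have [t7|t7] := leP (t a) 7.
  rewrite (le_trans (sqr_ln_le_cubic (t0 a)))//.
  (* Here [t a - 1 <= 6], so the cubic bound is at most [6 (t a - 1)^2], and [log2 K >= 3]. *)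
  have : 3 <= ln K / ln 2.
    rewrite ler_pdivlMr// mulr_natl -lnXn// ler_ln ?posrE//; last by lra.
    by rewrite -natrX; lra.
  have := sqr_ge0 (t a - 1); rewrite [_ ^+ 3]exprS; nra.
have : ln (t a) <= ln K by rewrite ler_ln ?posrE ?tK//; lra.
have : 49 / 36 * ln K <= ln K / ln 2.
  by rewrite mulrC ler_wpM2l// -[49/36]invf_div lef_pV2 ?posrE ?ln2_le.
have lnt0 : 0 <= ln (t a) by apply: ln_ge0; lra.
have : t a ^+ 2 <= 49 / 36 * (t a - 1) ^+ 2 by nra.
move=> H1 H2 H3.
have H4 : t a ^+ 2 * ln (t a) <= 49 / 36 * (t a - 1) ^+ 2 * ln K.
  by rewrite ler_pM// sqr_ge0.
have := ler_wpM2l (sqr_ge0 (t a - 1)) H2.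
have : 1 <= t a ^+ 2 by rewrite exprn_ege1//; lra.
by lra.
Qed.

(** Both sides are homogeneous, so [g] is normalised to mean one. With [s] the mean of [t^2], the
    entropy becomes [m^2] times the mean of [2 t^2 ln t] minus [s ln s]; the bound [s ln s >= s - 1]
    reduces it to the integrand of [expect_sqr_ln_le]. *)
Lemma Ent_sqr_le_ge0 g : (forall a, 0 <= g a) ->
  Ent nu (fun a => g a ^+ 2) <=
    2 * (ln K / ln 2) * expect nu (fun a => (g a - expect nu g) ^+ 2).
Proof.
move=> g0; set m := expect nu g.
have : 0 <= m by apply: expect_ge0.
rewrite le_eqVlt => /predU1P[/esym m0|m0].
  have g_eq0 := expect_eq0 nu_ge0 (fun a _ => g0 a) m0.
  rewrite (@eq_Ent _ _ _ nu_ge0 _ (fun=> 0)); last by move=> a /g_eq0 ->; rewrite expr0n.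
  rewrite /Ent !expect_cst// mul0r subrr (_ : expect _ _ = 0) ?mulr0//.
  by rewrite -(@expect_cst _ _ _ nu1 0); apply: eq_expect => // a /g_eq0 ->; rewrite m0 subrr expr0n.
have mn0 : m != 0 by rewrite gt_eqF.
pose t a := g a / m.
have gE a : g a = m * t a by rewrite /t mulrC divfK.
have t0 a : 0 <= t a by rewrite divr_ge0// ltW.
have t1 : expect nu t = 1.
  transitivity (m^-1 * expect nu g); last exact: mulVf.
  by rewrite -expectZ; apply: eq_bigr => a _; rewrite /t [g a / m]mulrC.
have -> : expect nu (fun a => (g a - m) ^+ 2) = m ^+ 2 * expect nu (fun a => (t a - 1) ^+ 2).
  by rewrite -expectZ; apply: eq_bigr => a _; rewrite gE; ring.
rewrite mulrCA (le_trans _ (ler_wpM2l (sqr_ge0 m) (expect_sqr_ln_le t0 t1)))//.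
rewrite /Ent.
have E2 : expect nu (fun a => g a ^+ 2) = m ^+ 2 * expect nu (fun a => t a ^+ 2).
  by rewrite -expectZ; apply: eq_bigr => a _; rewrite gE exprMn.
have -> : expect nu (fun a => g a ^+ 2 * ln (g a ^+ 2)) =
    m ^+ 2 * (expect nu (fun a => 2 * t a ^+ 2 * ln (t a)) +
     2 * ln m * expect nu (fun a => t a ^+ 2)).
  rewrite -!expectZ -expectD -expectZ; apply: eq_bigr => a _; congr (_ * _).
  rewrite gE; have := t0 a; rewrite le_eqVlt => /predU1P[<-|ta].
    by rewrite mulr0 expr0n/=; ring.
  by rewrite lnXn ?(mulr_gt0 m0 ta)// lnM ?posrE//; ring.
rewrite E2 expectD expectB expect_cst//.
set s := expect nu (fun a => t a ^+ 2).
have s1 : 1 <= s.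
  have : 0 <= expect nu (fun a => (t a - 1) ^+ 2) by apply: expect_ge0 => // a _; rewrite sqr_ge0.
  rewrite (_ : expect _ _ = expect nu (fun a => t a ^+ 2 - 2 * t a + 1)).
    by rewrite expectD expectB expectZ t1 expect_cst// -/s; lra.
  by apply: eq_bigr => a _; ring.
have s0 : 0 < s by lra.
rewrite lnM ?posrE ?exprn_gt0// lnXn// -mulr_natr.
have : 1 * s - s^-1 * s <= s * ln s.
  by rewrite -mulrBl mulrC ler_wpM2l ?(ltW s0)// sub1V_le_ln.
rewrite mulVf ?gt_eqF// mul1r => H.
rewrite -[X in _ - X]mulrA -mulrBr ler_wpM2l ?sqr_ge0//.
by lra.
Qed.

(** Replacing [g] by its absolute value keeps [g^2] and does not increase the differences. *)
Lemma Ent_sqr_le g : Ent nu (fun a => g a ^+ 2) <=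
  2 * (ln K / ln 2) * (2^-1 * \sum_a \sum_b (g a - g b) ^+ 2 * nu a * nu b).
Proof.
under [X in Ent _ X]boolp.funext do rewrite -real_normK ?num_real//.
have [a0 nua0] := prob_supp nu_prob.
rewrite (le_trans (Ent_sqr_le_ge0 (g := fun a => `|g a|) _))// -half_sum_sqr_sub//.
rewrite ler_wpM2l ?mulr_ge0 ?invr_ge0 ?ln_ge0 ?ler1n//.
  by have := atomK nua0; have := prob_le1 a0; nra.
rewrite ler_wpM2l ?invr_ge0// ler_sum// => a _; rewrite ler_sum// => b _.
rewrite !ler_wpM2r// -[leRHS]real_normK ?num_real// -[leLHS]real_normK ?num_real//.
by rewrite lerXn2r ?nnegrE// ler_dist_dist.
Qed.

End OneSite.

(** * Conditional laws of a spin system *)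

Lemma subset_setC1 (I : finType) (S : {set I}) i :
  (S \subset ~: [set i]) = (i \notin S).
Proof. by rewrite finset.subsetC finset.sub1set inE. Qed.

Section ConditionalLaw.
Context {R : realType} {X I : finType} (mu : {ffun I -> X} -> R).
Notation Y := {ffun I -> X}.
Hypothesis mu_ge0 : forall x, 0 <= mu x.
Implicit Types (S : {set I}) (x y z : Y) (i j : I) (a : X) (f : Y -> R).

Lemma agreeP S x y : reflect {in S, x =1 y} (agree S x y).
Proof.
by apply: (iffP forall_inP) => H j /H /eqP.
Qed.

Lemma agree_refl S x : agree S x x.
Proof. exact/agreeP. Qed.

Lemma agree_sym S x y : agree S x y = agree S y x.
Proof. by apply/agreeP/agreeP => H j /H. Qed.

Lemma agree_eql S x y z : agree S x y -> agree S x z = agree S y z.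
Proof. by move=> /agreeP H; apply/agreeP/agreeP => H' j jS; rewrite -H' ?H. Qed.

Lemma agreeS S S' x y : S \subset S' -> agree S' x y -> agree S x y.
Proof. by move=> /fintype.subsetP SS' /agreeP H; apply/agreeP => j /SS'/H. Qed.

Lemma agree_set0 x y : agree finset.set0 x y.
Proof. by apply/agreeP => j; rewrite inE. Qed.

Lemma agree_upd i x a : agree (~: [set i]) x (upd x i a).
Proof. by apply/agreeP => j; rewrite !inE ffunE => /negbTE ->. Qed.

Lemma agree_upd2 S i x y a : agree S x y -> agree S (upd x i a) (upd y i a).
Proof. by move=> /agreeP H; apply/agreeP => j /H xy; rewrite !ffunE xy. Qed.

Lemma upd_id i x y : agree (~: [set i]) x y -> upd x i (y i) = y.
Proof.
move=> /agreeP H; apply/ffunP => j; rewrite ffunE; case: eqP => [->//|/eqP ji].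
by rewrite H// !inE.
Qed.

Lemma upd_same i x a : upd x i a i = a.
Proof. by rewrite ffunE eqxx. Qed.

Lemma eq_marg S x y : agree S x y -> marg mu S x = marg mu S y.
Proof. by move=> xy; apply: eq_bigl => z; rewrite (agree_eql _ xy). Qed.

Lemma marg_ge0 S x : 0 <= marg mu S x.
Proof. exact: sumr_ge0. Qed.

Lemma marg_gt0 S x : 0 < mu x -> 0 < marg mu S x.
Proof.
by move=> mux; rewrite /marg (bigD1 x) ?agree_refl//= ltr_pwDl// sumr_ge0.
Qed.

(* The conditional law of the whole configuration given [x_S]: living on all
   configurations, conditional laws for different [S] compose without reindexing. *)
Definition claw S x z : R := (agree S x z)%:R * mu z / marg mu S x.

Lemma claw_ge0 S x z : 0 <= claw S x z.
Proof. by rewrite divr_ge0 ?mulr_ge0 ?marg_ge0. Qed.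

Lemma claw_gt0 S x z : 0 < claw S x z -> agree S x z /\ 0 < mu z.
Proof.
rewrite /claw; case: agree; last by rewrite !mul0r ltxx.
move=> H; split=> //; rewrite lt_neqAle mu_ge0 andbT; apply: contraTneq H => <-.
by rewrite mulr0 mul0r ltxx.
Qed.

Lemma claw_prob S x : 0 < marg mu S x -> is_prob (claw S x).
Proof.
move=> m0; split; first exact: claw_ge0.
rewrite -mulr_suml [X in X / _](_ : _ = marg mu S x) ?divff ?gt_eqF//.
by rewrite [RHS]big_mkcond; apply: eq_bigr => z _; case: agree; rewrite (mul1r, mul0r).
Qed.

Lemma eq_claw S x y : agree S x y -> claw S x =1 claw S y.
Proof. by move=> xy z; rewrite /claw (agree_eql _ xy) (eq_marg xy). Qed.

Lemma eq_expect_claw S x y f :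
  agree S x y -> expect (claw S x) f = expect (claw S y) f.
Proof. by move=> xy; apply: eq_bigr => z _; rewrite (eq_claw xy). Qed.

Lemma expect_clawE S x f :
  expect (claw S x) f = (\sum_(z | agree S x z) mu z * f z) / marg mu S x.
Proof.
rewrite mulr_suml [RHS]big_mkcond; apply: eq_bigr => z _; rewrite /claw.
by case: agree; rewrite ?mul0r// mul1r mulrAC.
Qed.

(** After exchanging sums, the weight of a given [w] collects the [z] that agree with [w] on [S'].
    They also agree with [w] on [S], and their total mass cancels [marg mu S' w]. *)
Lemma claw_tower S S' x f : S \subset S' ->
  expect (claw S x) (fun z => expect (claw S' z) f) = expect (claw S x) f.
Proof.
move=> SS'; rewrite /expect.
under eq_bigr do rewrite mulr_sumr.
rewrite exchange_big; apply: eq_bigr => w _.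
under eq_bigr do rewrite mulrA.
rewrite -mulr_suml; congr (_ * _).
have := mu_ge0 w; rewrite le_eqVlt => /predU1P[w0|w0].
  by rewrite /claw -w0 mulr0 mul0r big1// => z _; rewrite mulr0 mul0r mulr0.
transitivity (claw S x w / marg mu S' w * \sum_(z | agree S' w z) mu z); last first.
  by rewrite mulfVK// gt_eqF// marg_gt0.
rewrite mulr_sumr [RHS]big_mkcond; apply: eq_bigr => z _; rewrite /claw.
rewrite (agree_sym S' z); case: (boolP (agree S' w z)) => wz; last by rewrite !mul0r mulr0.
have -> : agree S x z = agree S x w.
  by rewrite !(agree_sym S x) (agree_eql _ (agreeS SS' wz)).
by rewrite (eq_marg wz) /=; ring.
Qed.

Lemma claw_pull S x f g : (forall z, agree S x z -> g z = g x) ->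
  expect (claw S x) (fun z => g z * f z) = g x * expect (claw S x) f.
Proof.
move=> gx; rewrite -expectZ; apply: eq_expect; first exact: claw_ge0.
by move=> z /claw_gt0[/gx ->].
Qed.

(** The mean of [E_S' f * ln (E_S' f)] occurs with both signs on the right; the tower property
    identifies the other terms. *)
Lemma claw_chain_rule S S' x f : S \subset S' ->
  Ent (claw S x) f = expect (claw S x) (fun z => Ent (claw S' z) f) +
    Ent (claw S x) (fun z => expect (claw S' z) f).
Proof. by move=> SS'; rewrite /Ent expectB !claw_tower//; lra. Qed.

Lemma sum_agree i x f :
  \sum_(z | agree (~: [set i]) x z) f z = \sum_a f (upd x i a).
Proof.
rewrite (reindex_onto (upd x i) (fun z => z i)) => [|z /upd_id//].
by apply: eq_bigl => a; rewrite agree_upd upd_same eqxx.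
Qed.

Lemma condiE i x a : condi mu x i a = mu (upd x i a) / marg mu (~: [set i]) x.
Proof.
rewrite /condi /cond (big_pred1 (upd x i a))// => z /=.
apply/andP/eqP => [[xz /eqP <-]|->]; first by rewrite upd_id.
by rewrite agree_upd upd_same eqxx.
Qed.

(** Translates between the one-site laws on [X] of the statement and the laws on configurations used
    in the proof. *)
Lemma expect_condi i x f :
  expect (condi mu x i) (fun a => f (upd x i a)) =
  expect (claw (~: [set i]) x) f.
Proof.
rewrite expect_clawE sum_agree mulr_suml; apply: eq_bigr => a _.
by rewrite condiE mulrAC.
Qed.

Lemma Ent_condi i x f :
  Ent (condi mu x i) (fun a => f (upd x i a)) = Ent (claw (~: [set i]) x) f.
Proof.
by rewrite /Ent expect_condi (expect_condi i x (fun z => f z * ln (f z))).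
Qed.

Lemma condi_prob i x : 0 < marg mu (~: [set i]) x -> is_prob (condi mu x i).
Proof.
move=> m0; split=> [a|]; first by rewrite condiE divr_ge0// ltW.
have := expect_condi i x (fun=> 1).
rewrite (expect_cst (claw_prob m0).2) => <-.
by apply: eq_bigr => a _; rewrite mulr1.
Qed.

Hypothesis mu1 : \sum_x mu x = 1.

Lemma claw_set0 x : claw finset.set0 x =1 mu.
Proof.
move=> z; rewrite /claw /marg agree_set0 mul1r.
by under eq_bigl do rewrite agree_set0; rewrite mu1 divr1.
Qed.

End ConditionalLaw.

(** * Dobrushin's comparison theorem *)

Section Norm2.
Context {R : realType} {I : finType}.
Implicit Types (u v : I -> R) (J : I -> I -> R) (c : R).

Lemma norm2_ge0 v : 0 <= norm2 v.
Proof. exact: sqrtr_ge0. Qed.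

Lemma sqr_norm2 v : norm2 v ^+ 2 = \sum_i v i ^+ 2.
Proof. by rewrite sqr_sqrtr// sumr_ge0// => i _; rewrite sqr_ge0. Qed.

Lemma ler_norm2 u v : (forall i, `|u i| <= `|v i|) -> norm2 u <= norm2 v.
Proof.
move=> uv; rewrite ler_wsqrtr// ler_sum// => i _.
rewrite -[leRHS]real_normK ?num_real// -[leLHS]real_normK ?num_real//.
by rewrite lerXn2r ?nnegrE.
Qed.

Lemma norm2Z c v : norm2 (fun i => c * v i) = `|c| * norm2 v.
Proof.
rewrite /norm2 -sqrtr_sqr -sqrtrM ?sqr_ge0// mulr_sumr.
by under eq_bigr do rewrite exprMn.
Qed.

(** Cauchy-Schwarz, from Lagrange's identity. *)
Lemma sum_mul_le_norm2 u v : \sum_i u i * v i <= norm2 u * norm2 v.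
Proof.
have [/ltW uv0|uv0] := ltP (\sum_i u i * v i) 0.
  by rewrite (le_trans uv0)// mulr_ge0 ?norm2_ge0.
rewrite -(@ler_pXn2r _ 2) ?nnegrE ?mulr_ge0 ?norm2_ge0//.
rewrite exprMn !sqr_norm2 -subr_ge0.
have : 0 <= \sum_i \sum_j (u i * v j - u j * v i) ^+ 2.
  by rewrite sumr_ge0// => i _; rewrite sumr_ge0// => j _; rewrite sqr_ge0.
suff -> : \sum_i \sum_j (u i * v j - u j * v i) ^+ 2 =
    2 * ((\sum_i u i ^+ 2) * (\sum_i v i ^+ 2) - (\sum_i u i * v i) ^+ 2).
  by rewrite pmulr_rge0.
have sum2 (f g : I -> R) : (\sum_i f i) * (\sum_j g j) = \sum_i \sum_j f i * g j.
  by rewrite mulr_suml; under eq_bigr do rewrite mulr_sumr.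
transitivity ((\sum_i u i ^+ 2) * (\sum_i v i ^+ 2) +
  (\sum_i v i ^+ 2) * (\sum_i u i ^+ 2) - 2 * ((\sum_i u i * v i) * (\sum_i u i * v i))); last by ring.
rewrite !sum2 mulr_sumr -big_split -sumrB; apply: eq_bigr => i _ /=.
rewrite mulr_sumr -big_split -sumrB; apply: eq_bigr => j _ /=; ring.
Qed.

Lemma norm2D u v : norm2 (fun i => u i + v i) <= norm2 u + norm2 v.
Proof.
rewrite -(@ler_pXn2r _ 2) ?nnegrE ?addr_ge0 ?norm2_ge0//.
rewrite sqrrD !sqr_norm2.
under eq_bigr do rewrite sqrrD.
rewrite !big_split /= lerD2r lerD2l -mulr2n lerMn2r.
exact: sum_mul_le_norm2.
Qed.

Lemma norm2_apply_mx J v : norm2 (apply_mx J v) <= opnorm2 J * norm2 v.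
Proof.
(* The supremum dominates its elements only once the set is known to be bounded. Coordinates of a
   vector in the unit ball are at most one, so absolute row sums give a bound. *)
have bnd : has_ubound [set norm2 (apply_mx J v) | v in [set v | norm2 v <= 1]]%classic.
  exists (norm2 (fun i => \sum_j `|J i j|)) => _ [w /= w1 <-].
  apply: ler_norm2 => i; rewrite [leRHS]ger0_norm ?sumr_ge0//.
  rewrite (le_trans (ler_norm_sum _ _ _))// ler_sum// => j _.
  rewrite normrM ler_piMr// -sqrtr_sqr (le_trans _ w1)//.
  by rewrite ler_wsqrtr// (bigD1 j)//= lerDl sumr_ge0// => k _; rewrite sqr_ge0.
have := norm2_ge0 v; rewrite le_eqVlt => /predU1P[v0|v0].
  have vi0 i : v i = 0.
    have /eqP : norm2 v ^+ 2 = 0 by rewrite -v0 expr0n.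
    rewrite sqr_norm2 psumr_eq0 => [/allP/(_ i (mem_index_enum i))|j _].
      by rewrite sqrf_eq0 => /eqP.
    by rewrite sqr_ge0.
  rewrite -v0 mulr0 (_ : norm2 _ = 0)// /norm2 big1 ?sqrtr0// => i _.
  by rewrite /apply_mx big1 ?expr0n// => j _; rewrite vi0 mulr0.
have v0' : 0 <= (norm2 v)^-1 by rewrite invr_ge0 ltW.
rewrite -ler_pdivrMr// mulrC -[X in X * _](ger0_norm v0').
rewrite -norm2Z; apply: (ub_le_sup bnd); exists (fun i => (norm2 v)^-1 * v i) => /=.
  by rewrite norm2Z ger0_norm// mulVf ?gt_eqF.
congr norm2; apply/boolp.funext => i; rewrite /apply_mx mulr_sumr.
by apply: eq_bigr => j _; rewrite mulrCA.
Qed.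

Lemma opnorm2_ge0 J (i : I) : 0 <= opnorm2 J.
Proof.
have n0 : 0 < norm2 (fun _ : I => 1 : R).
  rewrite /norm2 sqrtr_gt0 (bigD1 i)//= ltr_pwDl ?expr1n// sumr_ge0//.
have := norm2_apply_mx J (fun _ : I => 1 : R).
by move/(le_trans (norm2_ge0 _)); rewrite pmulr_lge0.
Qed.

End Norm2.

(** The infimum [m] of [A] satisfies [m <= r m + s], as one sees from near-minimisers; so
    [h <= m <= s / (1 - r)]. *)
Lemma lower_bound_of_contraction (R : realType) (A : set R) (r s h : R) :
  (A !=set0)%classic -> 0 <= r < 1 ->
  (forall x, A x -> exists2 y, A y & y <= r * x + s) ->
  (forall x, A x -> h <= x) -> h <= s / (1 - r).
Proof.
move=> A0 /andP[r0 r1] Astep hA.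
have infA : has_inf A by split=> //; exists h => x /hA.
have hm : h <= inf A by apply: lb_le_inf => // x /hA.
rewrite (le_trans hm)// ler_pdivlMr ?subr_gt0//.
apply/ler_addgt0Pr => e e0.
have [x Ax xm] := inf_adherent e0 infA.
have [y Ay yx] := Astep x Ax.
have : inf A <= y by apply: ge_inf => //; case: infA.
by nra.
Qed.

(** Since [h] has mean zero, a constant may be subtracted from [g]. On the atoms [g] lies within [c]
    below its maximum, so the midpoint of that interval leaves at most [c / 2]. *)
Lemma centered_expect_le (R : realType) (T : finType) (nu h g : T -> R) (c : R) :
  (forall z, 0 <= nu z) -> expect nu h = 0 ->
  (forall y z, 0 < nu y -> 0 < nu z -> `|g y - g z| <= c) ->
  `|expect nu (fun z => h z * g z)| <= 2^-1 * expect nu (fun z => `|h z|) * c.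
Proof.
move=> nu0 Eh gc.
have [/existsP[y0 nuy0]|/existsPn H] := boolP [exists y, 0 < nu y]; last first.
  rewrite !(eq_expect (g := fun=> 0) nu0)//; try by move=> x; rewrite (negbTE (H x)).
  by rewrite /expect big1 ?normr0 ?mulr0 ?mul0r// => z _; rewrite mulr0.
have [y nuy ymax] := @Order.TotalTheory.arg_maxP _ R T y0 [pred y | 0 < nu y] g nuy0.
rewrite (_ : expect _ _ = expect nu (fun z => h z * (g z - (g y - c / 2)))); last first.
  transitivity (expect nu (fun z => h z * g z) - (g y - c / 2) * expect nu h).
    by rewrite Eh mulr0 subr0.
  by rewrite -expectZ -expectB; apply: eq_bigr => z _; ring.
rewrite (le_trans (ler_norm_expect nu0 _))// [leRHS]mulrC mulrA -expectZ.
apply: ler_expect => // z nuz; rewrite normrM [leRHS]mulrC ler_wpM2l//.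
have /= := ymax z nuz; have := gc y z nuy nuz.
by rewrite !ler_norml => /andP[? ?] ?; apply/andP; split; lra.
Qed.

Section Comparison.
Context {R : realType} {X I : finType} (mu : {ffun I -> X} -> R).
Notation Y := {ffun I -> X}.
Context (K : Y -> I -> X -> R) (J : I -> I -> R) (alpha : R).
Hypotheses (mu_prob : is_prob mu) (K_version : is_version mu K)
  (J_diag : forall i, J i i = 0)
  (J_dTV : forall i j x y, agree (~: [set j]) x y -> dTV (K x i) (K y i) <= J i j)
  (alpha_gt0 : 0 < alpha) (J_norm : opnorm2 J <= 1 - alpha).
Let mu_ge0 := mu_prob.1.
Context (S : {set I}) (x : Y) (f : Y -> R).
Hypothesis marg_x : 0 < marg mu S x.
Implicit Types (phi : Y -> R) (c a : I -> R) (i j : I).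

Let F := expect (claw mu S x) f.

Definition osc phi c :=
  forall i y z, agree (~: [set i]) y z -> `|phi y - phi z| <= c i.

(* [F] times the difference between the integrals of [phi] under the law with
   density [f / F] and under the conditional law itself; [F] may vanish. *)
Definition discrepancy phi := expect (claw mu S x) (fun z => (f z - F) * phi z).

Definition site_error i :=
  2^-1 * expect (claw mu S x)
    (fun z => `|f z - expect (claw mu (~: [set i]) z) f|).

Definition marg_error i :=
  2^-1 * expect (claw mu S x) (fun z => `|expect (claw mu (i |: S) z) f - F|).

(** Dobrushin's estimates: vectors that bound the discrepancy in terms of single-site oscillations.
    They vanish on [S] because the coordinates in [S] are frozen. *)
Definition estimate a :=
  [/\ forall i, 0 <= a i, forall i, i \in S -> a i = 0 &
      forall phi c, osc phi c -> `|discrepancy phi| <= \sum_i a i * c i].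

Lemma osc_ge0 phi c i : osc phi c -> 0 <= c i.
Proof. by move/(_ i x x (agree_refl _ _)); rewrite subrr normr0. Qed.

(** The sites of [D] are changed one at a time. *)
Lemma osc_sum phi c (D : {set I}) y z : osc phi c -> agree (~: D) y z ->
  `|phi y - phi z| <= \sum_(i in D) c i.
Proof.
move=> phic; have [n] := ubnP #|D|; elim: n D y => // n IH D y Dn yz.
have [D0|[i iD]] := set_0Vmem D.
  rewrite D0 big_set0 (_ : y = z) ?subrr ?normr0//.
  by apply/ffunP => j; apply: (agreeP _ _ _ yz); rewrite D0 !inE.
rewrite (big_setD1 i)//= -(subrK (phi (upd y i (z i))) (phi y)) -addrA.
rewrite (le_trans (ler_normD _ _))// lerD//.
  by apply: phic; exact: agree_upd.
apply: IH; first by rewrite (cardsD1 i) iD in Dn.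
apply/agreeP => j; rewrite !inE ffunE negb_and negbK.
by case: eqP => [->//|_ /= jD]; apply: (agreeP _ _ _ yz); rewrite inE.
Qed.

Definition resample i phi y := \sum_a K y i a * phi (upd y i a).

Lemma resampleE i phi z : 0 < mu z ->
  resample i phi z = expect (claw mu (~: [set i]) z) phi.
Proof.
move=> muz; rewrite -expect_condi; apply: eq_bigr => a _.
by have [_ _ ->] := K_version; rewrite ?marg_gt0.
Qed.

(* Here [K] is needed as a kernel on all configurations: oscillations are taken
   off the support of [mu] as well. *)
Lemma osc_resample i phi c : osc phi c ->
  osc (resample i phi) (fun j => if j == i then 0 else c j + J i j * c i).
Proof.
move=> phic j y z yz; have [K_prob K_agree _] := K_version.
case: eqP => [ji|/eqP ji].
  rewrite ji in yz; rewrite (_ : resample _ _ _ = resample i phi z) ?subrr ?normr0//.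
  apply: eq_bigr => a _; rewrite (K_agree _ _ _ yz); congr (_ * phi _).
  apply/ffunP => k; rewrite !ffunE; case: eqP => // /eqP ki.
  by apply: (agreeP _ _ _ yz); rewrite !inE.
(* The first sum moves the argument of [phi] under a fixed kernel and costs [c j]. The second
   changes the kernel; its weights sum to zero, so [centered_expect_le] gives [J i j * c i]. *)
have -> : resample i phi y - resample i phi z =
    \sum_a K y i a * (phi (upd y i a) - phi (upd z i a)) +
    expect (fun=> 1 : R) (fun a : X => (K y i a - K z i a) * phi (upd z i a)).
  by rewrite -big_split -sumrB; apply: eq_bigr => a _ /=; ring.
rewrite (le_trans (ler_normD _ _))// lerD//.
  rewrite (le_trans (ler_norm_sum _ _ _))//.
  rewrite -[leRHS]mul1r -(K_prob y i).2 mulr_suml ler_sum// => a _.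
  rewrite normrM ger0_norm ?(K_prob y i).1// ler_wpM2l ?(K_prob y i).1//.
  by apply: phic; exact: agree_upd2.
rewrite (le_trans (centered_expect_le (c := c i) _ _ _))//.
- rewrite /expect; under eq_bigr do rewrite mul1r.
  by rewrite sumrB (K_prob y i).2 (K_prob z i).2 subrr.
- move=> a b _ _; apply: phic; apply/agreeP => k; rewrite !inE !ffunE.
  by move/negbTE ->.
rewrite ler_wpM2r ?(osc_ge0 _ phic)// (le_trans _ (J_dTV _ yz))//.
by rewrite /expect /dTV; under eq_bigr do rewrite mul1r.
Qed.

(** On the support, resampling is conditional expectation given the other coordinates. It is
    self-adjoint, so the centering passes from [phi] to [f] and [F] drops out; [centered_expect_le]
    then applies under each one-site law. *)
Lemma discrepancy_resample i phi c : i \notin S -> osc phi c ->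
  `|discrepancy phi - discrepancy (resample i phi)| <= site_error i * c i.
Proof.
move=> iS phic; have Si : S \subset ~: [set i] by rewrite subset_setC1.
pose E g z := expect (claw mu (~: [set i]) z) g.
have claw_ge0 T z w := claw_ge0 mu_ge0 T z w.
rewrite /discrepancy -expectB.
rewrite (eq_expect (g := fun z => (f z - F) * (phi z - E phi z)) _)//; last first.
  by move=> z /(claw_gt0 mu_ge0)[_ muz]; rewrite resampleE// mulrBr.
rewrite -(claw_tower mu_ge0 _ _ Si) (le_trans (ler_norm_expect _ _))//.
rewrite /site_error -[in leRHS](claw_tower mu_ge0 _ _ Si) [leRHS]mulrAC -expectZ.
apply: ler_expect => // z /(claw_gt0 mu_ge0)[_ muz].
have [_ P1] := claw_prob mu_ge0 (marg_gt0 mu_ge0 (~: [set i]) muz).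
rewrite [in leRHS](eq_expect (g := fun y => `|f y - E f z|) _)//; last first.
  by move=> y /(claw_gt0 mu_ge0)[zy _]; rewrite /E (eq_expect_claw _ _ zy).
rewrite (eq_expect (g := fun y => (f y - F) * (phi y - E phi z)) _)//; last first.
  by move=> y /(claw_gt0 mu_ge0)[zy _]; rewrite /E (eq_expect_claw _ _ zy).
have -> : expect (claw mu (~: [set i]) z) (fun y => (f y - F) * (phi y - E phi z)) =
    expect (claw mu (~: [set i]) z) (fun y => (f y - E f z) * phi y).
  transitivity (expect (claw mu (~: [set i]) z) (fun y => f y * phi y) - E phi z * E f z).
    transitivity (expect (claw mu (~: [set i]) z)
        (fun y => f y * phi y - E phi z * f y - F * phi y + F * E phi z)).
      by apply: eq_bigr => y _; congr (_ * _); ring.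
    by rewrite expectD !expectB !expectZ expect_cst// /E; ring.
  transitivity (expect (claw mu (~: [set i]) z) (fun y => f y * phi y - E f z * phi y)).
    by rewrite expectB expectZ mulrC.
  by apply: eq_bigr => y _; congr (_ * _); ring.
rewrite [leRHS]mulrAC; apply: centered_expect_le => //.
  by rewrite expectB expect_cst// subrr.
move=> y w /(claw_gt0 mu_ge0)[zy _] /(claw_gt0 mu_ge0)[zw _].
by apply: phic; rewrite -(agree_eql _ zy).
Qed.

(** A crude starting point: [phi x] may be subtracted from [phi], and the difference is at most the
    sum of the oscillations outside [S]. *)
Lemma estimate_init :
  estimate (fun i => if i \in S then 0 else expect (claw mu S x) (fun z => `|f z - F|)).
Proof.
have claw_ge0 z := claw_ge0 mu_ge0 S x z.
have D0 : 0 <= expect (claw mu S x) (fun z => `|f z - F|) by apply: expect_ge0.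
split=> [i|i ->//|phi c phic]; first by case: ifP.
have [_ P1] := claw_prob mu_ge0 marg_x.
have -> : discrepancy phi = expect (claw mu S x) (fun z => (f z - F) * (phi z - phi x)).
  transitivity (discrepancy phi - phi x * expect (claw mu S x) (fun z => f z - F)).
    by rewrite expectB expect_cst// subrr mulr0 subr0.
  by rewrite -expectZ -expectB; apply: eq_bigr => z _; congr (_ * _); ring.
rewrite (le_trans (ler_norm_expect _ _))//.
apply: (@le_trans _ _ (expect (claw mu S x)
    (fun z => (\sum_(i in ~: S) c i) * `|f z - F|))).
  apply: ler_expect => // z /(claw_gt0 mu_ge0)[xz _].
  rewrite normrM mulrC ler_wpM2r// (osc_sum phic)// finset.setCK.
  by rewrite agree_sym.
rewrite expectZ mulrC mulr_sumr big_mkcond ler_sum// => i _.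
by rewrite inE; case: (i \in S) => //=; rewrite mul0r.
Qed.

Lemma site_error_ge0 i : 0 <= site_error i.
Proof. by rewrite mulr_ge0 ?invr_ge0// expect_ge0//; exact: claw_ge0. Qed.

Lemma J_ge0 i j : 0 <= J i j.
Proof.
rewrite (le_trans _ (J_dTV i (agree_refl _ x)))// mulr_ge0 ?invr_ge0// sumr_ge0//.
Qed.

Lemma apply_J_ge0 a i : (forall i, 0 <= a i) -> 0 <= apply_mx J a i.
Proof. by move=> a0; rewrite sumr_ge0// => j _; rewrite mulr_ge0 ?J_ge0. Qed.

Let n : R := #|~: S|%:R.
Hypothesis n_gt0 : 0 < n.

Let n_inv_ge0 : 0 <= n^-1. Proof. by rewrite invr_ge0 ltW. Qed.
Let n_inv_le1 : n^-1 <= 1.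
Proof. by rewrite invf_le1// /n ler1n -(@ltr0n R). Qed.

(* Resampling one coordinate chosen uniformly outside [S]. *)
Definition improve a i :=
  if i \in S then 0 else a i + n^-1 * (apply_mx J a i + site_error i - a i).

(** For each free site, the triangle inequality through the resampled function combines
    [discrepancy_resample] with the old estimate applied to [osc_resample]. Averaging these bounds
    over the free sites gives [improve a]. *)
Lemma estimate_improve a : estimate a -> estimate (improve a).
Proof.
move=> [a0 aS a_est]; split=> [i|i|phi c phic].
- rewrite /improve; case: ifP => // _.
  have := apply_J_ge0 i a0; have := site_error_ge0 i; have := a0 i.
  have := n_inv_ge0; have := n_inv_le1; nra.
- by rewrite /improve => ->.
have step i : i \in ~: S -> `|discrepancy phi| <= \sum_j a j * c j +
    c i * (apply_mx J a i + site_error i - a i).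
  rewrite inE => iS.
  have H1 := discrepancy_resample iS phic.
  have H2 := a_est _ _ (osc_resample i phic).
  have H3 : \sum_j a j * (if j == i then 0 else c j + J i j * c i) =
      \sum_j a j * c j + c i * (apply_mx J a i - a i).
    rewrite /apply_mx (bigD1 i)//= eqxx mulr0 add0r [in RHS](bigD1 i)//=.
    rewrite [X in _ = _ + c i * (X - _)](bigD1 i)//= J_diag mul0r add0r.
    rewrite mulrBr mulr_sumr.
    transitivity (\sum_(j | j != i) a j * c j + \sum_(j | j != i) c i * (J i j * a j)); last by ring.
    by rewrite -big_split; apply: eq_bigr => j /negbTE -> /=; ring.
  have := ler_normD (discrepancy phi - discrepancy (resample i phi)) (discrepancy (resample i phi)).
  rewrite subrK; lra.
have : \sum_(i in ~: S) `|discrepancy phi| <= \sum_(i in ~: S)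
   (\sum_j a j * c j + c i * (apply_mx J a i + site_error i - a i)) by exact: ler_sum.
rewrite sumr_const -mulr_natl -/n big_split /= sumr_const -[_ *+ _]mulr_natl -/n.
move=> /(ler_wpM2l n_inv_ge0); rewrite mulrDr !mulKf ?gt_eqF// => /le_trans; apply.
rewrite mulr_sumr [X in _ + X]big_mkcond -big_split ler_sum// => i _ /=.
rewrite /improve inE; case: (boolP (i \in S)) => iS /=; last first.
  rewrite le_eqVlt; apply/predU1P; left; ring.
by rewrite aS// addr0.
Qed.

(** Outside [S], [improve a] is [(1 - 1/n) a + (1/n) J a + (1/n) site_error]; the first two terms
    have norm at most [(1 - 1/n) + (1/n) (1 - alpha)] times that of [a]. *)
Lemma norm2_improve a : estimate a ->
  norm2 (improve a) <= (1 - n^-1 * alpha) * norm2 a +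
    n^-1 * norm2 (fun i => if i \in S then 0 else site_error i).
Proof.
move=> [a0 aS _].
rewrite -(ger0_norm n_inv_ge0) -norm2Z (ger0_norm n_inv_ge0).
have H : norm2 (fun i => (1 - n^-1) * a i + n^-1 * apply_mx J a i) <=
    (1 - n^-1 * alpha) * norm2 a.
  rewrite (le_trans (norm2D _ _))// !norm2Z !ger0_norm ?subr_ge0//.
  have := norm2_apply_mx J a; have := norm2_ge0 a.
  have := n_inv_ge0; have := J_norm => H1 H2 H3 H4.
  have : norm2 (apply_mx J a) <= (1 - alpha) * norm2 a by nra.
  by nra.
rewrite (le_trans _ (lerD H (lexx _)))// (le_trans _ (norm2D _ _))//.
apply: ler_norm2 => i; rewrite /improve; case: ifP => iS.
  by rewrite normr0.
rewrite le_eqVlt; apply/predU1P; left; congr `|_|; ring.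
Qed.

(** The test function is half the sign of [g - F], whose discrepancy is exactly [marg_error i]. It
    depends only on the coordinates in [i |: S] and oscillates by at most one; as [a] vanishes on
    [S], only [a i] remains. *)
Lemma marg_error_le a i : i \notin S -> estimate a -> marg_error i <= a i.
Proof.
move=> iS [a0 aS a_est].
have claw_ge0 T z w := claw_ge0 mu_ge0 T z w.
have Si : S \subset i |: S by exact: finset.subsetUr.
pose g z := expect (claw mu (i |: S) z) f.
pose phi z := 2^-1 * Num.sg (g z - F).
have phi_eq z y : agree (i |: S) z y -> phi z = phi y.
  by move=> zy; rewrite /phi /g (eq_expect_claw _ _ zy).
have phic : osc phi (fun j => (j \in i |: S)%:R).
  move=> j y z yz; case: (boolP (j \in _)) => jS /=.
    rewrite /phi -mulrBr normrM ger0_norm ?invr_ge0//.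
    have := ler_normB (Num.sg (g y - F)) (Num.sg (g z - F)).
    have sg1 w : `|Num.sg w| <= 1 :> R by rewrite normr_sg; case: eqP.
    have := sg1 (g y - F); have := sg1 (g z - F); lra.
  rewrite (phi_eq y z) ?subrr ?normr0//; apply: agreeS yz.
  by rewrite subset_setC1.
have := a_est _ _ phic; rewrite (bigD1 i)//= finset.setU11 mulr1 big1 ?addr0; last first.
  move=> j ji; rewrite !inE (negbTE ji) /=; case: (boolP (j \in S)) => [/aS ->|_].
    by rewrite mul0r.
  by rewrite mulr0.
apply: le_trans; rewrite (le_trans _ (ler_norm _))// le_eqVlt; apply/predU1P; left.
rewrite /discrepancy -(claw_tower mu_ge0 _ _ Si) /marg_error -expectZ.
apply: eq_expect => // z /(claw_gt0 mu_ge0)[_ muz].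
have [_ P1] := claw_prob mu_ge0 (marg_gt0 mu_ge0 (i |: S) muz).
transitivity (expect (claw mu (i |: S) z) (fun y => phi y * (f y - F))); last first.
  by apply: eq_bigr => y _; rewrite [phi y * _]mulrC.
rewrite claw_pull//; last by move=> y zy; rewrite (phi_eq z y).
rewrite expectB expect_cst// -/(g z) /phi -mulrA; congr (_ * _).
by rewrite -normrEsg.
Qed.

(* Estimates are improved by random-site resampling; the infimum of their norms
   is controlled by the contraction property, so no limit is needed. *)
Lemma comparison :
  \sum_(i in ~: S) marg_error i ^+ 2 <=
    alpha ^- 2 * \sum_(i in ~: S) site_error i ^+ 2.
Proof.
pose h i := if i \in S then 0 else marg_error i.
pose e i := if i \in S then 0 else site_error i.
have [i0 _] : exists i0, i0 \in ~: S.
  by apply/set0Pn; rewrite -card_gt0 -(@ltr0n R).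
(* This makes the contraction factor [1 - alpha / n] nonnegative. *)
have alpha_le1 : alpha <= 1 by have := opnorm2_ge0 J i0; have := J_norm; lra.
have : norm2 h <= n^-1 * norm2 e / (1 - (1 - n^-1 * alpha)).
  apply: (@lower_bound_of_contraction _ [set norm2 a | a in estimate]%classic).
  - by exists (norm2 (fun i => if i \in S then 0 else expect (claw mu S x) (fun z => `|f z - F|)));
      eexists; first exact: estimate_init.
  - rewrite subr_ge0 ltrBlDr ltrDl mulr_gt0 ?invr_gt0// andbT.
    by rewrite mulr_ile1// ltW.
  - move=> _ [a a_est <-]; exists (norm2 (improve a)); last exact: norm2_improve.
    by exists (improve a) => //; exact: estimate_improve.
  - move=> _ [a a_est <-]; apply: ler_norm2 => i; rewrite /h.
    case: ifPn => iS; first by rewrite normr0.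
    have m0 : 0 <= marg_error i.
      by rewrite mulr_ge0 ?invr_ge0// expect_ge0//; exact: claw_ge0.
    have := marg_error_le iS a_est; rewrite !ger0_norm//.
    by have [] := a_est.
rewrite (_ : _ / _ = alpha^-1 * norm2 e); last first.
  by field; rewrite !gt_eqF.
have E u : \sum_(i in ~: S) u i ^+ 2 = norm2 (fun i => if i \in S then 0 else u i) ^+ 2 :> R.
  rewrite sqr_norm2 big_mkcond; apply: eq_bigr => i _.
  by rewrite inE; case: (i \in S); rewrite //= expr0n.
rewrite !E -exprVn -exprMn => he.
by apply: lerXn2r he; rewrite nnegrE ?mulr_ge0 ?norm2_ge0// invr_ge0 ltW.
Qed.

End Comparison.

(** * Tensorization of entropy *)

Section EntropyDensity.
Context {R : realType}.
Implicit Types a b s : R.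

Lemma xlnx_sub_ge a b : 0 <= a -> 0 < b -> a - b <= a * ln a - a * ln b.
Proof.
rewrite le_eqVlt => /predU1P[<- b0|a0 b0]; first by rewrite !mul0r; lra.
have := sub1V_le_ln (divr_gt0 a0 b0); rewrite ln_div ?posrE// invf_div => H.
rewrite -mulrBr; have -> : a - b = a * (1 - b / a) by field; rewrite gt_eqF.
by rewrite ler_pM2l.
Qed.

(** From [ln t <= t - 1] at [t = a / b]; integrated, it bounds entropy by the chi-square
    divergence. *)
Lemma xlnx_sub_le a b : 0 <= a -> 0 < b ->
  a * ln a - a * ln b <= a * (a - b) / b.
Proof.
rewrite le_eqVlt => /predU1P[<- b0|a0 b0]; first by rewrite !mul0r subrr.
rewrite -mulrBr -mulrA ler_pM2l// -ln_div ?posrE//.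
have := @le_ln1Dx R (a / b - 1); rewrite addrCA subrr addr0.
rewrite (_ : (a - b) / b = a / b - 1); last by field; rewrite gt_eqF.
by apply; rewrite ltrBrDr addNr divr_gt0.
Qed.

Lemma sqr_sub_le_xlnx a b : 0 <= a -> 0 < b ->
  3 * (a - b) ^+ 2 <= (2 * a + 4 * b) * (a * ln a - a * ln b - a + b).
Proof.
move=> a0 b0; have := sqr_sub1_le_entropy (divr_ge0 a0 (ltW b0)).
have -> : a / b * ln (a / b) = (a * ln a - a * ln b) / b.
  move: a0; rewrite le_eqVlt => /predU1P[<-|a0]; first by rewrite !mul0r subrr mul0r.
  by rewrite ln_div ?posrE//; field; rewrite gt_eqF.
rewrite -(ler_pM2l (exprn_gt0 2 b0)) => H; apply: le_trans (le_trans H _).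
  by rewrite le_eqVlt; apply/predU1P; left; field; rewrite gt_eqF.
by rewrite le_eqVlt; apply/predU1P; left; field; rewrite gt_eqF.
Qed.

(* Pinsker's inequality at the level of densities, linearised by AM-GM. *)
Lemma norm_sub_le_xlnx a b s : 0 <= a -> 0 < b -> 0 < s ->
  `|a - b| <= s * (2 * a + 4 * b) / 6 +
    (2 * s)^-1 * (a * ln a - a * ln b - a + b).
Proof.
move=> a0 b0 s0; have H := sqr_sub_le_xlnx a0 b0.
have G0 := xlnx_sub_ge a0 b0.
set G := a * ln a - a * ln b in H G0 *.
set A := (2 * a + 4 * b) in H *.
have A0 : 0 < A by rewrite /A; lra.
suff : (2 * s) * `|a - b| <= s ^+ 2 * A / 3 + (G - a + b).
  rewrite mulrC -ler_pdivlMr ?mulr_gt0// => /le_trans; apply.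
  by rewrite le_eqVlt; apply/predU1P; left; field; rewrite gt_eqF.
have B0 : 0 <= G - a + b by lra.
have s2A : 0 <= s ^+ 2 * A by rewrite mulr_ge0 ?sqr_ge0 ?(ltW A0).
have s20 : 0 <= 2 * s by lra.
(* After squaring, [4 s^2 (a - b)^2 <= (4 / 3) s^2 A (G - a + b)] by [H], and AM-GM bounds this by
   the square of the right side. *)
rewrite -(@ler_pXn2r _ 2) ?nnegrE ?(mulr_ge0 s20)//; last by lra.
rewrite exprMn real_normK ?num_real//.
have : 0 <= (s ^+ 2 * A / 3 - (G - a + b)) ^+ 2 by rewrite sqr_ge0.
have := ler_wpM2l (sqr_ge0 s) H.
by lra.
Qed.

(** Jensen's inequality: [xlnx_sub_ge] with [b] the mean is integrated. If the mean is zero, [f]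
    vanishes on all atoms. *)
Lemma Ent_ge0 (T : finType) (nu : T -> R) f : is_prob nu ->
  (forall z, 0 < nu z -> 0 <= f z) -> 0 <= Ent nu f.
Proof.
move=> [nu0 nu1] f0; have := expect_ge0 nu0 f0; set m := expect nu f.
rewrite le_eqVlt => /predU1P[m0|m0].
  rewrite /Ent -/m -m0 mul0r subr0 expect_ge0// => z nuz.
  by rewrite (expect_eq0 nu0 f0 _ nuz) ?mul0r// -/m.
have : expect nu (fun z => f z - m) <= expect nu (fun z => f z * ln (f z) - ln m * f z).
  by apply: ler_expect => // z nuz; rewrite (mulrC (ln m)) xlnx_sub_ge ?f0.
by rewrite !expectB expect_cst// expectZ -/m /Ent subrr mulrC.
Qed.

End EntropyDensity.

Section Tensorization.
Context {R : realType} {X I : finType} (mu : {ffun I -> X} -> R).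
Notation Y := {ffun I -> X}.
Context (K : Y -> I -> X -> R) (J : I -> I -> R) (alpha1 alpha2 : R).
Hypotheses (mu_prob : is_prob mu) (K_version : is_version mu K)
  (J_diag : forall i, J i i = 0)
  (J_dTV : forall i j x y, agree (~: [set j]) x y -> dTV (K x i) (K y i) <= J i j)
  (alpha1_gt0 : 0 < alpha1) (alpha2_gt0 : 0 < alpha2)
  (J_norm : opnorm2 J <= 1 - alpha2)
  (cond_ge : forall (S : {set I}) (x y : Y) i, i \notin S ->
    0 < marg mu S x -> 0 < mu (Defs.glue S x y) -> alpha1 <= cond mu S x i (y i)).
Let mu_ge0 := mu_prob.1.
Context (f : Y -> R).
Hypothesis f_ge0 : forall x, 0 <= f x.
Implicit Types (S : {set I}) (x : Y) (i : I).
Let claw_ge0 S x z : 0 <= claw mu S x z. Proof. exact: claw_ge0. Qed.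

Let E S x := expect (claw mu S x) f.
Let E_ge0 S x : 0 <= E S x. Proof. exact: expect_ge0. Qed.

Lemma expect_Ent_ge0 S x i :
  0 <= expect (claw mu S x) (fun z => Ent (claw mu (~: [set i]) z) f).
Proof.
apply: expect_ge0 => // z /(claw_gt0 mu_ge0)[_ muz].
by apply: Ent_ge0 => //; apply: claw_prob => //; apply: marg_gt0.
Qed.

Lemma site_error_sqr_le S x i : i \notin S -> 0 < E S x ->
  site_error mu S x f i ^+ 2 <= 2^-1 * E S x *
    expect (claw mu S x) (fun z => Ent (claw mu (~: [set i]) z) f).
Proof.
move=> iS F0; set A := expect _ _; rewrite /site_error.
have A0 : 0 <= A by exact: expect_Ent_ge0.
have Si : S \subset ~: [set i] by rewrite subset_setC1.
pose G z := expect (claw mu (~: [set i]) z) f.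
have EG : expect (claw mu S x) G = E S x by exact: claw_tower.
set e := expect _ _.
have e0 : 0 <= e by exact: expect_ge0.
have e_le s : 0 < s -> e <= s * E S x + (2 * s)^-1 * A.
  move=> s0.
  (* [ln (G z)] is constant under the law given the coordinates off [i], so [f ln G] and [G ln G]
     have equal means; the added [- f + G] has mean zero. *)
  have -> : A = expect (claw mu S x) (fun z => f z * ln (f z) - f z * ln (G z) - f z + G z).
    rewrite expectD !expectB EG /A /Ent expectB claw_tower// -/(E S x) subrK.
    congr (_ - _); rewrite -[RHS](claw_tower mu_ge0 _ _ Si).
    apply: eq_expect => // z /(claw_gt0 mu_ge0)[_ muz].
    rewrite [in RHS](eq_expect (g := fun w => ln (G w) * f w) _)//; last first.
      by move=> w _; rewrite mulrC.
    rewrite (@claw_pull _ _ _ _ mu_ge0 _ _ _ (fun w => ln (G w))) 1?mulrC// => w zw.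
    by rewrite /G (eq_expect_claw _ _ zw).
  have -> : s * E S x = expect (claw mu S x) (fun z => s / 6 * (2 * f z + 4 * G z)).
    by rewrite expectZ expectD !expectZ EG -/(E S x); field.
  rewrite -expectZ -expectD; apply: ler_expect => // z /(claw_gt0 mu_ge0)[_ muz].
  have : 0 <= G z by exact: expect_ge0.
  rewrite -/(G z) le_eqVlt => /predU1P[G0|G0].
    have -> : f z = 0.
      apply: (expect_eq0 (nu := claw mu (~: [set i]) z)) => //.
      by rewrite /claw agree_refl mul1r divr_gt0// marg_gt0.
    by rewrite -G0 !mul0r !subr0 normr0 !mulr0 !addr0 !mulr0 addr0.
  have := norm_sub_le_xlnx (f_ge0 z) G0 s0; lra.
suff : e ^+ 2 <= 2 * E S x * A by rewrite exprMn; lra.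
move: e0; rewrite le_eqVlt => /predU1P[<-|e0].
  by rewrite expr0n/= !mulr_ge0.
(* This choice of [s] gives [e <= e / 2 + E S x * A / e], that is [e^2 <= 2 * E S x * A], without
   square roots. *)
have := e_le (e / (2 * E S x)) (divr_gt0 e0 (mulr_gt0 (ltr0n _ 2) F0)).
have -> : e / (2 * E S x) * E S x + (2 * (e / (2 * E S x)))^-1 * A =
    e / 2 + E S x * A / e by field; rewrite !gt_eqF.
rewrite -lerBlDl ler_pdivlMr//; nra.
Qed.

Lemma cond_expect S x i a :
  cond mu S x i a = expect (claw mu S x) (fun w => (w i == a)%:R).
Proof.
rewrite expect_clawE /cond big_mkcondr; congr (_ / _); apply: eq_bigr => z _.
by case: eqP; rewrite (mulr1, mulr0).
Qed.

Lemma Ent_marg_le S x i : i \notin S -> 0 < marg mu S x -> 0 < E S x ->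
  Ent (claw mu S x) (fun z => expect (claw mu (i |: S) z) f) <=
    2 / (E S x * alpha1) * marg_error mu S x f i ^+ 2.
Proof.
move=> iS m0 F0; set F := E S x in F0 *.
have Si : S \subset i |: S by exact: finset.subsetUr.
have [_ P1] := claw_prob mu_ge0 m0.
pose g z := E (i |: S) z; pose h z := g z - F.
have Eg : expect (claw mu S x) g = F by exact: claw_tower.
have Eh : expect (claw mu S x) h = 0 by rewrite expectB expect_cst// Eg subrr.
have -> : marg_error mu S x f i = 2^-1 * expect (claw mu S x) (fun z => `|h z|) by [].
set e := expect _ (fun z => `|h z|).
(* Given [x_S], [h] depends on coordinate [i] only. Thus [|h z|] times the mass of the event
   [w i = z i] is the absolute mean of [h] over that event, at most [e / 2] since [h] is centered
   and the indicator oscillates by at most one. *)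
have hz z : 0 < claw mu S x z -> `|h z| * alpha1 <= 2^-1 * e.
  move=> clz; have [xz muz] := claw_gt0 mu_ge0 clz.
  have glue_z : Defs.glue S x z = z.
    by apply/ffunP => j; rewrite ffunE; case: ifP => // /(agreeP _ _ _ xz).
  have q_ge : alpha1 <= cond mu S x i (z i) by rewrite cond_ge// glue_z.
  rewrite (le_trans (ler_wpM2l (normr_ge0 _) q_ge))//.
  rewrite cond_expect -[X in _ * X]ger0_norm ?expect_ge0// -normrM -expectZ.
  rewrite (eq_expect (g := fun w => h w * (w i == z i)%:R) _)//; last first.
    move=> w /(claw_gt0 mu_ge0)[xw _]; case: eqP => [wz|]; last by rewrite !mulr0.
    congr (_ * _); congr (_ - _); apply: eq_expect_claw; apply/agreeP => j.
    rewrite !inE => /predU1P[->//|jS].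
    by rewrite -(agreeP _ _ _ xz)// -(agreeP _ _ _ xw).
  rewrite -[leRHS]mulr1; apply: centered_expect_le => // y w _ _.
  by case: eqP; case: eqP; rewrite /= ?subrr ?subr0 ?sub0r ?normrN ?normr1 ?normr0.
have Eh2 : expect (claw mu S x) (fun z => h z ^+ 2) <= 2^-1 * e / alpha1 * e.
  rewrite -expectZ; apply: ler_expect => // z clz.
  by rewrite -real_normK ?num_real// expr2 ler_wpM2r// ler_pdivlMr// hz.
have H : Ent (claw mu S x) g <= F^-1 * expect (claw mu S x) (fun z => h z ^+ 2).
  rewrite /Ent Eg -{1}Eg mulrC -expectZ -expectB.
  apply: (@le_trans _ _ (expect (claw mu S x) (fun z => F^-1 * h z ^+ 2 + h z))).
    (* Here [g (g - F) / F = h^2 / F + h], and the linear term integrates to zero. *)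
    apply: ler_expect => // z _; rewrite [ln F * _]mulrC.
    rewrite (le_trans (xlnx_sub_le (E_ge0 _ _) F0))// le_eqVlt; apply/predU1P; left.
    by rewrite /h /g; field; rewrite gt_eqF.
  by rewrite expectD Eh addr0 expectZ.
rewrite (le_trans H)// (le_trans (ler_wpM2l _ Eh2)) ?invr_ge0 ?(ltW F0)//.
by rewrite le_eqVlt; apply/predU1P; left; field; rewrite !gt_eqF.
Qed.

(** The factors multiply to [2 / (F alpha1) * alpha2^-2 * F / 2], so the mean [F] of [f] cancels;
    the case [F = 0] is separate, all [E (i |: S)] being zero there. *)
Lemma sum_Ent_marg_le S x : 0 < marg mu S x ->
  \sum_(i in ~: S) Ent (claw mu S x) (fun z => expect (claw mu (i |: S) z) f) <=
    (alpha1 * alpha2 ^+ 2)^-1 * \sum_(i in ~: S)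
      expect (claw mu S x) (fun z => Ent (claw mu (~: [set i]) z) f).
Proof.
move=> m0.
have C0 : 0 <= (alpha1 * alpha2 ^+ 2)^-1.
  by rewrite invr_ge0 mulr_ge0 ?sqr_ge0// ltW.
have RHS0 : 0 <= (alpha1 * alpha2 ^+ 2)^-1 * \sum_(i in ~: S)
    expect (claw mu S x) (fun z => Ent (claw mu (~: [set i]) z) f).
  by rewrite mulr_ge0// sumr_ge0// => i _; exact: expect_Ent_ge0.
have := E_ge0 S x; rewrite le_eqVlt => /predU1P[F0|F0].
  rewrite big1// => i; rewrite inE => iS.
  have Si : S \subset i |: S by exact: finset.subsetUr.
  have g0 : forall z, 0 < claw mu S x z -> E (i |: S) z = 0.
    by apply: expect_eq0 => //; rewrite claw_tower// F0.
  rewrite (@eq_Ent _ _ _ (claw_ge0 S x) _ (fun=> 0))//.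
  have [_ P1] := claw_prob mu_ge0 m0.
  by rewrite /Ent !expect_cst// subrr.
have [S0|] := posnP #|~: S|.
  by rewrite [leLHS]big1// => i; rewrite (cards0_eq S0) inE.
rewrite -(@ltr0n R) => n0.
apply: (@le_trans _ _ (2 / (E S x * alpha1) *
    \sum_(i in ~: S) marg_error mu S x f i ^+ 2)).
  rewrite mulr_sumr ler_sum// => i; rewrite inE => iS.
  exact: Ent_marg_le.
have c0 : 0 <= 2 / (E S x * alpha1) by rewrite divr_ge0// ltW// mulr_gt0.
rewrite (le_trans (ler_wpM2l c0 (comparison mu_prob K_version J_diag J_dTV
  alpha2_gt0 J_norm _ m0 n0)))//.
apply: (@le_trans _ _ (2 / (E S x * alpha1) * (alpha2 ^- 2 *
  \sum_(i in ~: S) (2^-1 * E S x *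
    expect (claw mu S x) (fun z => Ent (claw mu (~: [set i]) z) f))))).
  rewrite ler_wpM2l// ler_wpM2l ?invr_ge0 ?sqr_ge0// ler_sum// => i.
  by rewrite inE => iS; exact: site_error_sqr_le.
rewrite -mulr_sumr le_eqVlt; apply/predU1P; left.
by field; rewrite !gt_eqF.
Qed.

Lemma claw_setT x z : 0 < claw mu finset.setT x z -> z = x.
Proof.
move=> /(claw_gt0 mu_ge0)[/agreeP xz _]; apply/ffunP => j.
by rewrite -xz// inE.
Qed.

Lemma Ent_tensorization S x : 0 < marg mu S x ->
  Ent (claw mu S x) f <= (alpha1 * alpha2 ^+ 2)^-1 * \sum_(i in ~: S)
    expect (claw mu S x) (fun z => Ent (claw mu (~: [set i]) z) f).
Proof.
have [n] := ubnP #|~: S|; elim: n S x => // n IH S x Sn m0.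
have [S0|n0] := posnP #|~: S|.
  have ST : S = finset.setT by rewrite -[S]finset.setCK (cards0_eq S0) finset.setC0.
  rewrite (cards0_eq S0) big_set0 mulr0 ST in m0 *.
  have [_ P1] := claw_prob mu_ge0 m0.
  rewrite (@eq_Ent _ _ _ (claw_ge0 _ x) _ (fun=> f x)); last by move=> z /claw_setT ->.
  by rewrite /Ent !expect_cst// subrr.
set C := (alpha1 * _)^-1.
pose A i := expect (claw mu S x) (fun z => Ent (claw mu (~: [set i]) z) f).
rewrite -[X in _ <= _ * X]/(\sum_(i in ~: S) A i).
have C0 : 0 <= C by rewrite invr_ge0 mulr_ge0 ?sqr_ge0// ltW.
have nR : 0 < #|~: S|%:R :> R by rewrite ltr0n.
rewrite -(ler_pM2l nR).
have step i : i \in ~: S -> expect (claw mu S x) (fun z => Ent (claw mu (i |: S) z) f) <=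
    C * (\sum_(j in ~: S) A j - A i).
  move=> iS; have Si : S \subset i |: S by exact: finset.subsetUr.
  have E1 : \sum_(j in ~: S) A j - A i = \sum_(j in ~: (i |: S)) A j.
    rewrite (big_setD1 i)//= addrAC subrr add0r; apply: eq_bigl => j.
    by rewrite !inE negb_or.
  rewrite E1; under eq_bigr do rewrite /A -(claw_tower mu_ge0 _ _ Si).
  rewrite -expect_sum -expectZ; apply: ler_expect => // z /(claw_gt0 mu_ge0)[_ muz].
  apply: IH; last exact: marg_gt0.
  rewrite -ltnS (leq_trans _ Sn)// ltnS (cardsD1 i (~: S)) iS add1n ltnS.
  by apply: subset_leq_card; apply/fintype.subsetP => j; rewrite !inE negb_or.
have : \sum_(i in ~: S) Ent (claw mu S x) f <=
    \sum_(i in ~: S) (C * (\sum_(j in ~: S) A j - A i) +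
      Ent (claw mu S x) (fun z => expect (claw mu (i |: S) z) f)).
  apply: ler_sum => i iS; rewrite (claw_chain_rule _ _ _ (_ : S \subset i |: S)) ?finset.subsetUr//.
  by rewrite lerD2r step.
rewrite sumr_const -[_ *+ _]mulr_natl => /le_trans; apply.
(* With [n] free sites, the induction hypothesis contributes [n - 1] copies of [C] times the sum of
   the [A j], each site omitting its own term; the marginal entropies supply the missing copy. *)
rewrite big_split /= -mulr_sumr sumrB sumr_const -mulr_natl.
have := sum_Ent_marg_le m0; rewrite -/C -/A; lra.
Qed.

End Tensorization.

(** * Weakly dependent spin systems *)

Section WeakDependence.
Context {R : realType} {X I : finType} (mu : {ffun I -> X} -> R).
Notation Y := {ffun I -> X}.
Hypothesis mu_prob : is_prob mu.
Let mu_ge0 := mu_prob.1.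
Implicit Types (x y : Y) (i : I).

Lemma beta_tilde_cond (alpha : R) : (alpha%:E <= beta_tilde mu)%E ->
  forall (S : {set I}) x y i, i \notin S -> 0 < marg mu S x ->
    0 < mu (Defs.glue S x y) -> alpha <= cond mu S x i (y i).
Proof.
move=> /ereal_infP ab S x y i iS mx my; rewrite -lee_fin.
have S_proper : S \proper finset.setT.
  rewrite finset.properT; apply: contraNneq iS => ->; exact: finset.in_setT.
have /ereal_infP/(_ (beta_tilde_at mu i S)) := ab _ (ex_intro2 _ _ S S_proper erefl).
move=> /(_ (ex_intro2 _ _ i iS erefl))/ereal_infP/(_ _ (ex_intro2 _ _ x mx erefl)).
by move=> /ereal_infP; apply; exists y.
Qed.

Lemma expect_supp (g : Y -> R) :
  expect (mu \o val : {x | x \in supp mu} -> R) (g \o val) = expect mu g.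
Proof.
rewrite /expect -(big_sub (supp mu) (fun x => mu x * g x)) big_mkcond.
apply: eq_bigr => x _; rewrite inE; case: ifPn => //; rewrite -leNgt => mux.
by rewrite (_ : mu x = 0) ?mul0r//; apply: le_anti; rewrite mux mu_ge0.
Qed.

Lemma glauberE (u v : {x | x \in supp mu}) :
  glauber u v = #|I|%:R^-1 * \sum_i claw mu (~: [set i]) (val u) (val v).
Proof.
congr (_ * _); apply: eq_bigr => i _; rewrite /claw condiE.
have -> : \prod_(j | j != i) (val u j == val v j)%:R =
    (agree (~: [set i]) (val u) (val v))%:R :> R.
  case: (boolP (agree _ _ _)) => [/agreeP uv|/forall_inPn[j]].
    by rewrite big1// => j ji; rewrite uv ?eqxx// !inE.
  by rewrite !inE => ji uvj; rewrite (bigD1 j)//= (negbTE uvj) mul0r.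
case: (boolP (agree _ _ _)) => uv; last by rewrite mulr0 !mul0r.
by rewrite upd_id// mulr1 mul1r.
Qed.

(** Restricting the sum to the support loses nothing, since [claw] charges no configuration off
    it. *)
Lemma generatorE (h : Y -> R) (u : {x | x \in supp mu}) :
  generator (h \o val) u =
    #|I|%:R^-1 * \sum_i expect (claw mu (~: [set i]) (val u)) h - h (val u).
Proof.
congr (_ - _); under eq_bigr do rewrite glauberE -mulrA mulr_suml.
rewrite -mulr_sumr exchange_big; congr (_ * _); apply: eq_bigr => i _ /=.
rewrite /expect -(big_sub (supp mu) (fun y => claw mu (~: [set i]) (val u) y * h y)).
rewrite big_mkcond; apply: eq_bigr => y _; rewrite inE; case: ifPn => //.
rewrite -leNgt => muy; rewrite /claw (_ : mu y = 0) ?mulr0 ?mul0r//.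
by apply: le_anti; rewrite muy mu_ge0.
Qed.

Lemma dirichletE (g h : Y -> R) : (0 < #|I|)%N ->
  dirichlet (g \o val : {x | x \in supp mu} -> R) (h \o val) = #|I|%:R^-1 * \sum_i expect mu
    (fun y => g y * (h y - expect (claw mu (~: [set i]) y) h)).
Proof.
move=> I0; have n0 : #|I|%:R != 0 :> R by rewrite pnatr_eq0 -lt0n.
rewrite -expect_sum -expectZ -expect_supp; apply: eq_bigr => u _; congr (_ * _) => /=.
rewrite generatorE -mulr_sumr sumrB sumr_const -[_ *+ _]mulr_natl.
by field.
Qed.

(** The terms [g ln g] agree on both sides by the tower property; what remains is Jensen's
    inequality for [ln] under each one-site law, weighted by the mean of [g]. *)
Lemma expect_Ent_le_covariance (g : Y -> R) i : (forall y, 0 < mu y -> 0 < g y) ->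
  expect mu (fun x => Ent (claw mu (~: [set i]) x) g) <=
  expect mu (fun y => g y *
    (ln (g y) - expect (claw mu (~: [set i]) y) (fun z => ln (g z)))).
Proof.
move=> g0; have [x0 _] := prob_supp mu_prob.
have claw_ge0 S x z := claw_ge0 mu_ge0 S x z.
pose E f z := expect (claw mu (~: [set i]) z) f.
have E0 f : expect (claw mu finset.set0 x0) f = expect mu f.
  by apply: eq_bigr => z _; rewrite claw_set0// mu_prob.2.
have tower f : expect mu (E f) = expect mu f.
  by rewrite -!E0 claw_tower// finset.sub0set.
apply: (@le_trans _ _ (expect mu (fun y => g y * ln (g y)) -
    expect mu (fun y => E (fun z => ln (g z)) y * g y))); last first.
  by rewrite -expectB le_eqVlt; apply/predU1P; left; apply: eq_bigr => y _; rewrite /E; ring.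
rewrite /Ent expectB -/(E _ _) [X in X - _](tower (fun y => g y * ln (g y))) lerD2l lerN2.
rewrite -[leLHS]tower; apply: ler_expect => // z muz.
have P := claw_prob mu_ge0 (marg_gt0 mu_ge0 (~: [set i]) muz).
rewrite /E claw_pull//; last by move=> y zy; rewrite (eq_expect_claw _ _ zy).
rewrite -/(E g z) mulrC.
have g_ge0 y : 0 < claw mu (~: [set i]) z y -> 0 < g y.
  by move=> /(claw_gt0 mu_ge0)[_ /g0].
have G0 : 0 < E g z.
  rewrite lt_neqAle expect_ge0// ?andbT; last by move=> y /g_ge0/ltW.
  rewrite eq_sym; apply/eqP => /(expect_eq0 (claw_ge0 _ z)) H.
  have [y clzy] := prob_supp P.
  by have := g_ge0 y clzy; rewrite H ?ltxx// => w /g_ge0/ltW.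
rewrite ler_pM2l//.
(* The tangent of [ln] at the mean of [g]. *)
apply: (@le_trans _ _ (expect (claw mu (~: [set i]) z)
    (fun y => ln (E g z) - 1 + (E g z)^-1 * g y))).
  apply: ler_expect => // y /g_ge0 gy.
  have := sub1V_le_ln (divr_gt0 G0 gy); rewrite ln_div ?posrE// invf_div.
  by rewrite [_^-1 * _]mulrC; lra.
by rewrite expectD expect_cst ?P.2// expectZ mulVf ?gt_eqF// subrK.
Qed.

Variables alpha1 alpha2 : R.
Hypotheses (alpha1_gt0 : 0 < alpha1) (alpha2_gt0 : 0 < alpha2)
  (mu_weak : weakly_dependent mu alpha1 alpha2).
Let C := (alpha1 * alpha2 ^+ 2)^-1.
Let C_ge0 : 0 <= C.
Proof. by rewrite invr_ge0 mulr_ge0 ?sqr_ge0// ltW. Qed.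

(** The case of empty [S], in which the conditional law is [mu] whatever the base configuration. *)
Lemma weakly_dependent_tensorization (f : Y -> R) : (forall x, 0 <= f x) ->
  Ent mu f <= C * \sum_i expect mu (fun x => Ent (claw mu (~: [set i]) x) f).
Proof.
move=> f0; have [J [J_diag [K K_version J_dTV]] [ab J_norm]] := mu_weak.
have [x0 mux0] := prob_supp mu_prob.
have E0 g : expect (claw mu finset.set0 x0) g = expect mu g.
  by apply: eq_bigr => z _; rewrite claw_set0// mu_prob.2.
have := Ent_tensorization mu_prob K_version J_diag J_dTV alpha1_gt0 alpha2_gt0
  J_norm (beta_tilde_cond ab) f0 (marg_gt0 mu_ge0 finset.set0 mux0).
rewrite /Ent !E0 => /le_trans; apply; rewrite le_eqVlt; apply/predU1P; left.
congr (_ * _); rewrite finset.setC0; apply: eq_big => i; first by rewrite inE.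
by rewrite E0.
Qed.

Lemma weakly_dependent_mLSI : mLSI mu (2 * #|I|%:R * alpha1^-1 * alpha2 ^- 2).
Proof.
move=> f f0.
pose g y := if insub y is Some u then f u else 0 : R.
have fE : f = g \o val by apply/boolp.funext => u; rewrite /g /= valK.
have lnE : (fun u => ln (f u)) = (fun y => ln (g y)) \o val by rewrite fE.
have g0 y : 0 < mu y -> 0 < g y.
  by move=> muy; rewrite /g; case: insubP => [u _ _|]; [exact: f0|rewrite inE muy].
have g_ge0 y : 0 <= g y by rewrite /g; case: insub => // u; exact: ltW.
have -> : Ent (mu \o val) f = Ent mu g.
  by rewrite fE /Ent expect_supp (expect_supp (fun y => g y * ln (g y))).
rewrite (le_trans (weakly_dependent_tensorization g_ge0))//.
have [I0|I0] := posnP #|I|.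
  rewrite I0 mulr0 !mul0r big_pred0 ?mulr0// => i.
  by have := card0_eq I0 i.
rewrite lnE fE dirichletE//.
have n0 : #|I|%:R != 0 :> R by rewrite pnatr_eq0 -lt0n.
(* The factor [#|I|] compensates the uniform choice of a site in the Glauber dynamics. *)
have -> : 2 * #|I|%:R * alpha1^-1 * alpha2 ^- 2 / 2 = C * #|I|%:R.
  by rewrite /C; field; rewrite !gt_eqF.
rewrite -mulrA mulVKf// ler_wpM2l// ler_sum// => i _.
exact: expect_Ent_le_covariance.
Qed.

Lemma weakly_dependent_dLSI : dLSI mu (ln (alpha1^-1) * (ln 2 * alpha1 * alpha2 ^+ 2)^-1).
Proof.
move=> f; have [J _ [ab _]] := mu_weak.
pose g y := if 0 < mu y then f y ^+ 2 else 0.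
rewrite (@eq_Ent _ _ _ mu_ge0 _ g); last by move=> y muy; rewrite /g muy.
have g_ge0 y : 0 <= g y by rewrite /g; case: ifP => // _; exact: sqr_ge0.
rewrite (le_trans (weakly_dependent_tensorization g_ge0))//.
have l2 : 0 < ln 2 :> R by rewrite ln_gt0// ltr1n.
have -> : 2 * (ln alpha1^-1 * (ln 2 * alpha1 * alpha2 ^+ 2)^-1) =
    C * (2 * (ln alpha1^-1 / ln 2)).
  by rewrite /C; field; rewrite !gt_eqF.
rewrite -mulrA ler_wpM2l// -expect_sum -expectZ.
apply: ler_expect => // x mux.
rewrite /diff_norm sqr_sqrtr; last by rewrite sumr_ge0// => i _; exact: sqr_ge0.
rewrite mulr_sumr ler_sum// => i _.
have m0 := marg_gt0 mu_ge0 (~: [set i]) mux.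
have P := condi_prob mu_ge0 m0.
rewrite -Ent_condi (@eq_Ent _ _ _ P.1 _ (fun a => f (upd x i a) ^+ 2)); last first.
  move=> a; rewrite condiE pmulr_lgt0 ?invr_gt0// => mua.
  by rewrite /g mua.
rewrite /diff_i m0 sqr_sqrtr; last first.
  rewrite mulr_ge0 ?invr_ge0// sumr_ge0// => a _; rewrite sumr_ge0// => b _.
  by rewrite mulr_ge0 ?P.1// mulr_ge0 ?P.1// sqr_ge0.
(* The one-site inequality with [K = alpha1^-1]: the bound on [beta_tilde] at [S = ~: [set i]]
   controls the atoms. *)
apply: Ent_sqr_le => // a ca.
rewrite -ler_pdivrMl ?invr_gt0// invrK mulr1.
rewrite -[a in condi _ _ _ a](upd_same i x a).
apply: (beta_tilde_cond ab) => //; first by rewrite !inE eqxx.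
rewrite (_ : Defs.glue _ _ _ = upd x i a).
  by move: ca; rewrite condiE pmulr_lgt0 ?invr_gt0.
by apply/ffunP => j; rewrite !ffunE !inE; case: eqP.
Qed.

End WeakDependence.

Theorem theorem4p1 (R : realType) (X I : finType) (mu : {ffun I -> X} -> R)
    (alpha1 alpha2 : R) (mu_prob : is_prob mu)
    (alpha1_gt0 : 0 < alpha1) (alpha2_gt0 : 0 < alpha2)
    (mu_weak : weakly_dependent mu alpha1 alpha2) :
  [/\ forall f : {ffun I -> X} -> R,
        (forall x, 0 <= f x) -> (forall x, x \notin supp mu -> f x = 0) ->
        Ent mu f <= (alpha1 * alpha2 ^+ 2)^-1 *
          \sum_i expect mu (fun x => Ent (condi mu x i) (fun a => f (upd x i a))),
      mLSI mu (2 * #|I|%:R * alpha1^-1 * alpha2 ^- 2)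
    & dLSI mu (ln (alpha1^-1) * (ln 2 * alpha1 * alpha2 ^+ 2)^-1)].
Proof.
split=> [f f_ge0 _||]; last 2 first.
- exact: weakly_dependent_mLSI.
- exact: weakly_dependent_dLSI.
under eq_bigr => i _ do rewrite (eq_expect mu_prob.1 (fun x _ => Ent_condi mu i x f)).
exact: weakly_dependent_tensorization.
Qed.
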